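(* The semi-dual functional $J = J_{\mu,\nu}$, $J(z) = \int \varphi^*(z-q)\,d\mu + \int \varphi^*(z^*-q)\,d\nu$, is convex. Assume that $\varphi^*$ is differentiable and that $\nu$ is absolutely continuous with respect to the Lebesgue measure. Let $z$ be a $\lambda$-strongly convex potential ($\lambda>0$) and let $z_0$ be the optimal potential. Then $$J(z) - J(z_0) \;\geq\; \frac{1}{2\lambda}\, \mathbb{E}_{\tilde{\nu}}\big[\| \nabla (z_0^* - z^* )\|^2\big] + C_{z^*}\, \mathbb{E}_{\nu}\big[(z_0^* - z^* )^2\big] + C_z\, \mathbb{E}_{\mu}\big[(z_0 - z)^2\big],$$ where $\tilde\nu = (\varphi^* )'(z_0^*-q)\,\nu$ and where $C_z, C_{z^*}\ge 0$ are nonnegative constants depending on $\varphi^*$ and $z$. Moreover, if $z$ and $z^*$ are uniformly bounded on the supports of $\mu$ and $\nu$ respectively, and if $\varphi^*$ is strongly convex on every compact set, then $C_z$ and $C_{z^*}$ are uniformly lower bounded by a constant $C'>0$.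
   Context: $X,Y\subset\mathbb{R}^d$ are compact, and $\mu$, $\nu$ are nonnegative finite measures on $X$ and $Y$ respectively. $q(x)=\frac12\|x\|^2$. For a positive measure $\beta$, $\mathbb{E}_\beta[f]=\int f\,d\beta$. $\varphi:\mathbb{R}_+\to\mathbb{R}_+\cup\{+\infty\}$ is a convex lower semicontinuous function with $\varphi(1)=0$ (entropy function), and $\varphi^*$ is its Legendre transform, $\varphi^*(s)=\sup_{r\ge 0}(rs-\varphi(r))$. For a function $z$ (a potential), $z^*(y)=\sup_x(\langle x,y\rangle - z(x))$ denotes its Fenchel-Legendre transform, the supremum being over the domain of $z$. The unbalanced optimal transport problem with quadratic cost $c(x,y)=q(x-y)$ and both marginal constraints penalized by the Csiszár divergence of $\varphi$ has the semi-dual formulation $-\inf\{J_{\mu,\nu}(z) : z\in C_b(X),\ z \text{ convex}\}$, where $C_b(X)$ is the set of bounded continuous functions on $X$. The optimal potential $z_0$ is a minimizer of this problem. ''Uniformly lower bounded'' means: as $z$ ranges over a family of $\lambda$-strongly convex potentials for which $|z|$ on $\mathrm{supp}(\mu)$ and $|z^*|$ on $\mathrm{supp}(\nu)$ are bounded by a common constant, the inequality holds with constants $C_z, C_{z^*}\ge C'$ with the same $C'>0$ for the whole family.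
   Formalization: The coefficient of the gradient term is λ/2 instead of 1/(2λ), which is false for small λ (X=Y=[0,1], Lebesgue, φ*(s)=s, z_0=x²/2, z=x², λ<1/2); a convex potential on X is taken to have a convex domain X. *)

(* Defs.v *)
From mathcomp Require Import all_boot all_order all_algebra.
From mathcomp Require Import all_classical all_reals all_analysis.

Set Implicit Arguments.
Unset Strict Implicit.
Unset Printing Implicit Defensive.

Import Order.TTheory GRing.Theory Num.Theory.
Import numFieldNormedType.Exports.

Local Open Scope classical_set_scope.
Local Open Scope ring_scope.

(* 'rV[R]_d carries the sup norm in the library; the Euclidean structure is
   given by [dot].  The sup norm is only used through its topology and the
   notion of derivative, which do not depend on the choice of norm. *)
Definition dot (R : realType) (d : nat) (x y : 'rV[R]_d) : R :=
  \sum_(i < d) x 0 i * y 0 i.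

Definition sqnorm (R : realType) (d : nat) (x : 'rV[R]_d) : R := dot x x.

Definition q (R : realType) (d : nat) (x : 'rV[R]_d) : R := sqnorm x / 2.

Definition grad (R : realType) (d : nat) (f : 'rV[R]_d -> R) (x : 'rV[R]_d) :
  'rV[R]_d := \row_(i < d) 'D_(delta_mx 0 i) f x.

(* R^d with its Borel sigma-algebra *)
Notation borelRV R d := (g_sigma_algebraType (@open 'rV[R]_d)).

(* d-dimensional Lebesgue measure, as the iterated product of the
   one-dimensional one:
   leb_(n+1)(A) = \int leb_n({y | (t, y) \in A}) dt. *)
Fixpoint lebesgue_rV (R : realType) (d : nat) : set (borelRV R d) -> \bar R :=
  match d with
  | 0 => fun A => \d_(0 : borelRV R 0) A
  | n.+1 => fun A => (\int[@lebesgue_measure R]_t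
      lebesgue_rV [set y : 'rV[R]_n | A (row_mx (const_mx t : 'rV[R]_1) y)])%E
  end.

Definition supp (R : realType) (d : nat) (m : set 'rV[R]_d -> \bar R) :
  set 'rV[R]_d := [set x | forall U, open U -> U x -> (0 < m U)%E].

(* phi : R_+ -> R_+ \cup {+oo}; only the values of phi on [0, +oo[ matter.
   Semicontinuity is relative to [0, +oo[, via the subspace topology. *)
Definition entropy_function (R : realType) (phi : R -> \bar R) : Prop :=
  [/\ forall r, 0 <= r -> (0 <= phi r)%E,
      forall r s t, 0 <= r -> 0 <= s -> 0 <= t <= 1 ->
        (phi (t * r + (1 - t) * s)%R
           <= t%:E * phi r + (1 - t)%R%:E * phi s)%E,
      lower_semicontinuous
        (phi : subspace [set r : R | 0 <= r] -> \bar R) &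
      phi 1 = 0%E].

Definition legendre (R : realType) (phi : R -> \bar R) (s : R) : \bar R :=
  ereal_sup [set ((r * s)%:E - phi r)%E | r in [set r : R | 0 <= r]].

(* The functions below are total on R^d, but a potential is meant as a function
   on X: its values outside of X are never used. *)
Definition fenchel (R : realType) (d : nat) (X : set 'rV[R]_d)
    (z : 'rV[R]_d -> R) (y : 'rV[R]_d) : R :=
  sup [set dot x y - z x | x in X].

Definition Cb (R : realType) (d : nat) (X : set 'rV[R]_d)
    (z : 'rV[R]_d -> R) : Prop :=
  {within X, continuous z} /\ exists M : R, forall x, X x -> `|z x| <= M.

(* A function defined on X is convex when its domain X is a convex set and the
   convexity inequality holds on X. *)
Definition convex_on (R : realType) (d : nat) (X : set 'rV[R]_d)
    (z : 'rV[R]_d -> R) : Prop :=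
  convex_set (M := 'rV[R]_d) X /\ convex_function (E := 'rV[R]_d) X z.

(* z - (lambda / 2) |.|^2 is convex on X *)
Definition strongly_convex_on (R : realType) (d : nat) (X : set 'rV[R]_d)
    (lambda : R) (z : 'rV[R]_d -> R) : Prop :=
  convex_on X (fun x => z x - lambda * q x).

Definition strongly_convex_on_compacts (R : realType) (f : R -> R) : Prop :=
  forall K : set R, compact K -> exists2 a : R, 0 < a &
    convex_function (E := R^o) K (fun s => f s - a / 2 * s ^+ 2).

Definition semidual (R : realType) (d : nat) (X Y : set 'rV[R]_d)
    (mu nu : set (borelRV R d) -> \bar R) (phi : R -> \bar R)
    (z : 'rV[R]_d -> R) : \bar R :=
  (\int[mu]_(x in X) legendre phi (z x - q x)
   + \int[nu]_(y in Y) legendre phi (fenchel X z y - q y))%E.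

Definition optimal_potential (R : realType) (d : nat) (X Y : set 'rV[R]_d)
    (mu nu : set (borelRV R d) -> \bar R) (phi : R -> \bar R)
    (z0 : 'rV[R]_d -> R) : Prop :=
  [/\ Cb X z0, convex_on X z0 &
      forall z, Cb X z -> convex_on X z ->
        (semidual X Y mu nu phi z0 <= semidual X Y mu nu phi z)%E].

(* Main.v *)
Require Import Defs.
From mathcomp Require Import all_boot all_order all_algebra.
From mathcomp Require Import all_classical all_reals all_analysis.
From mathcomp Require Import measurable_realfun.
From mathcomp Require Import ring lra.

Import Order.TTheory GRing.Theory Num.Theory.
Import numFieldNormedType.Exports.

Local Open Scope classical_set_scope.
Local Open Scope ring_scope.

(** Why the estimate holds.

   Put h = z - z0 and z_n = z0 + h / (n + 1).  Since z0 is optimal,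
   J(z) - J(z0) is at least J(z) - J(z0) - (n + 1) (J(z_n) - J(z0)), which is
   the integral over X of a function A_n plus the integral over Y of a function
   B_n ([defect], [sum_defects_le]).  Both are nonnegative because phi^* is
   convex and nondecreasing and because conjugation is convex, so Fatou's lemma
   bounds J(z) - J(z0) from below by the integrals of the inferior limits
   ([semidual_gap]).  This replaces the differentiation of J at z0.

   The inferior limits are bounded pointwise.  On X, strong convexity of phi^*
   leaves a multiple of (z - z0)^2 ([defect_ge0]).  On Y, suppose that y has
   only one maximizer x0 in the definition of z0^*(y).  Then z_n^*(y) decreases
   at rate h(x0) to first order ([danskin]), and the linear part of B_n tends to
   the derivative of phi^* at z0^*(y) - q(y) times z^*(y) + z(x0) - <x0, y>.
   The last factor is the Fenchel-Young gap of the strongly convex z, hence at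
   least lambda / 2 |x0 - x1|^2 for the maximizer x1 of z^*(y)
   ([strongly_convex_gap]), and x0 - x1 is the gradient of z0^* - z^* at y
   ([conjugate_defect]).

   A maximizer is a subgradient of the conjugate, so it is determined as soon as
   all partial derivatives of the conjugate exist at y.  For a convex function,
   the points where one of them is missing are kinks, and the kinks in one
   coordinate direction form a Lebesgue null set ([kink_null]): on a line there
   are boundedly many kinks of size at least eps ([kink1_card]), hence only
   countably many hyperplanes orthogonal to that line can meet the set of kinks
   in positive measure.

   The last point and the treatment of the gradient term use that the integral
   of a nonnegative function is a supremum over simple functions below it: it
   is monotone and superadditive whether or not the function is measurable.

   For the uniform constants, the same estimate with lambda = 0 compares two
   optimal potentials: when phi^* is strongly convex on compact sets they agree
   almost everywhere ([optimal_unique]).  All arguments of phi^* then stay, up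
   to null sets, in one interval that depends only on one optimal potential and
   on the bound imposed on the family ([stable_with_uniform]). *)

(** * Lower integrals *)

(** Either [c] is infinite, or all the numbers involved are finite and the two
    suprema can be taken one after the other. *)
Lemma ereal_supD_le {R : realType} (A B : set (\bar R)) (c : \bar R) :
  A !=set0 -> B !=set0 ->
  (forall a, A a -> 0 <= a)%E -> (forall b, B b -> 0 <= b)%E ->
  (forall a b, A a -> B b -> a + b <= c)%E ->
  (ereal_sup A + ereal_sup B <= c)%E.
Proof.
move=> [a0 Aa0] [b0 Bb0] Age Bge Hc.
have c0 : (0 <= c)%E.
  by apply: le_trans (Hc _ _ Aa0 Bb0); apply: adde_ge0; [exact: Age|exact: Bge].
have [->|cfin] := eqVneq c +oo%E; first by rewrite leey.
have fin a : (0 <= a -> a <= c -> a \is a fin_num)%E.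
  by move=> a_ge0 ac; rewrite ge0_fin_numE//; apply: le_lt_trans ac _; rewrite ltey.
have Bfin b : B b -> b \is a fin_num.
  move=> Bb; apply: fin; first exact: Bge.
  by apply: le_trans (Hc _ _ Aa0 Bb); rewrite leeDr// Age.
have HA b : B b -> (ereal_sup A <= c - b)%E.
  move=> Bb; apply: ge_ereal_sup => a Aa.
  by rewrite leeBrDr ?Bfin//; exact: Hc.
have supAf : ereal_sup A \is a fin_num.
  apply: fin; first by apply: le_trans (Age _ Aa0) _; exact: ereal_sup_ubound.
  apply: le_trans (HA _ Bb0) _; rewrite leeBlDr ?Bfin// leeDl//.
  exact: Bge.
rewrite addeC -leeBrDr//; apply: ge_ereal_sup => b Bb.
by rewrite leeBrDr// addeC -leeBrDr ?Bfin//; exact: HA.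
Qed.

Section lower_integral.
Context {disp : measure_display} {T : measurableType disp} {R : realType}.
Variable mu : {measure set T -> \bar R}.
Import HBNNSimple.

(** The integral is the supremum of the integrals of the simple functions
    below the integrand, and those below [f] are below [g]. *)
Lemma le_lower_integral (D : set T) (f g : T -> \bar R) :
  (forall x, D x -> 0 <= f x)%E -> (forall x, D x -> f x <= g x)%E ->
  (\int[mu]_(x in D) f x <= \int[mu]_(x in D) g x)%E.
Proof.
move=> f0 fg; rewrite !ge0_integralE//; last first.
  by move=> x Dx; apply: le_trans (fg _ Dx); exact: f0.
apply: ereal_sup_le => _ /= [h hf <-]; exists h => // x.
apply: le_trans (hf x) _; rewrite /patch; case: ifPn => // xD.
by apply: fg; rewrite inE in xD.
Qed.

(** A simple function below [f] and one below [g] add up to a simple function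
    below [f + g]. *)
Lemma lower_integralD (f g : T -> \bar R) :
  (forall x, 0 <= f x)%E -> (forall x, 0 <= g x)%E ->
  (\int[mu]_x f x + \int[mu]_x g x <= \int[mu]_x (f x + g x))%E.
Proof.
move=> f0 g0; rewrite !ge0_integralTE//; last by move=> x; exact: adde_ge0.
apply: ereal_supD_le.
- by exists 0%E; exists nnsfun0 => //; exact: sintegral0.
- by exists 0%E; exists nnsfun0 => //; exact: sintegral0.
- by move=> _ [h _ <-]; exact: sintegral_ge0.
- by move=> _ [h _ <-]; exact: sintegral_ge0.
move=> _ _ [h1 hf1 <-] [h2 hf2 <-]; apply: ereal_sup_ubound.
exists (h1 \+ h2)%R; last by rewrite -sintegralD.
by move=> x /=; rewrite EFinD; exact: leeD.
Qed.

End lower_integral.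

Section iterated_lower_integral.
Context {R : realType}.

(** The functional on nonnegative functions of which [lebesgue_rV] is the
    restriction to indicators: sums of indicators, which are not sets, have to
    be integrated below. *)
Fixpoint iter_integral (n : nat) : ('rV[R]_n -> \bar R) -> \bar R :=
  match n with
  | 0 => fun g => g 0
  | n.+1 => fun g => (\int[@lebesgue_measure R]_t
      iter_integral n (fun y : 'rV[R]_n => g (row_mx (const_mx t : 'rV[R]_1) y)))%E
  end.

Lemma iter_integral_ge0 n (g : 'rV[R]_n -> \bar R) :
  (forall y, 0 <= g y)%E -> (0 <= iter_integral n g)%E.
Proof.
by elim: n g => [|n IH] g g0 //=; apply: integral_ge0 => t _; exact: IH.
Qed.

Lemma le_iter_integral n (f g : 'rV[R]_n -> \bar R) :
  (forall y, 0 <= f y)%E -> (forall y, f y <= g y)%E ->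
  (iter_integral n f <= iter_integral n g)%E.
Proof.
elim: n f g => [|n IH] f g f0 fg //=.
apply: le_lower_integral => t _; last exact: IH.
exact: iter_integral_ge0.
Qed.

Lemma iter_integralD n (f g : 'rV[R]_n -> \bar R) :
  (forall y, 0 <= f y)%E -> (forall y, 0 <= g y)%E ->
  (iter_integral n f + iter_integral n g
    <= iter_integral n (fun y => f y + g y))%E.
Proof.
elim: n f g => [|n IH] f g f0 g0 //=.
apply: le_trans (lower_integralD _ _ _ _ _) _.
- by move=> t; exact: iter_integral_ge0.
- by move=> t; exact: iter_integral_ge0.
apply: le_lower_integral => t _; last exact: IH.
by apply: adde_ge0; exact: iter_integral_ge0.
Qed.

Lemma iter_integral_sum n (I : Type) (s : seq I) (f : I -> 'rV[R]_n -> \bar R) :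
  (forall i y, 0 <= f i y)%E ->
  (\sum_(i <- s) iter_integral n (f i)
    <= iter_integral n (fun y => \sum_(i <- s) f i y))%E.
Proof.
move=> f0; elim: s => [|i s IH].
  rewrite big_nil; apply: iter_integral_ge0 => y.
  by rewrite big_nil.
rewrite big_cons; apply: (@le_trans _ _
  (iter_integral n (f i) + iter_integral n (fun y => \sum_(i <- s) f i y))%E).
  exact: leeD2l.
apply: le_trans (iter_integralD _ _ _ _ _) _ => //.
  by move=> y; apply: sume_ge0.
apply: le_iter_integral => y; last by rewrite big_cons.
by apply: adde_ge0 => //; apply: sume_ge0.
Qed.

Lemma lebesgue_rVE n (A : set 'rV[R]_n) :
  lebesgue_rV A = iter_integral n (fun y => (\1_A y)%:E).
Proof.
elim: n A => [|n IH] A /=; first by rewrite diracE indicE.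
by apply: eq_integral => t _; rewrite IH.
Qed.

Definition box n (M : R) (y : 'rV[R]_n) : bool := [forall i, `|y 0 i| <= M].

Lemma box_row_mx n (M t : R) (y : 'rV[R]_n) :
  box n.+1 M (row_mx (const_mx t : 'rV[R]_1) y) = (`|t| <= M) && box n M y.
Proof.
apply/forallP/andP => [H|[tM /forallP H] i].
  split.
    have <- : row_mx (const_mx t : 'rV[R]_1) y 0 (lshift n (ord0 : 'I_1)) = t.
      by rewrite row_mxEl mxE.
    exact: H.
  apply/forallP => i; have <- : row_mx (const_mx t : 'rV[R]_1) y 0 (rshift 1 i) = y 0 i.
    by rewrite row_mxEr.
  exact: H.
have [j ->|j ->] := @split_ordP 1 n i.
  by rewrite (row_mxEl (const_mx t : 'rV[R]_1) y) mxE.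
by rewrite (row_mxEr (const_mx t : 'rV[R]_1) y).
Qed.

Lemma iter_integral_box n (M c : R) (g : 'rV[R]_n -> \bar R) : 0 <= M -> 0 <= c ->
  (forall y, 0 <= g y)%E -> (forall y, g y <= (if box n M y then c else 0)%:E)%E ->
  (iter_integral n g <= (c * (2 * M) ^+ n)%:E)%E.
Proof.
move=> M0 c0; elim: n g => [|n IH] g g0 gc /=.
  by rewrite expr0 mulr1; apply: le_trans (gc _) _; case: ifP.
have step : (\int[@lebesgue_measure R]_t
      iter_integral n (fun y => g (row_mx (const_mx t : 'rV[R]_1) y))
    <= \int[@lebesgue_measure R]_(t in `[(- M)%R, M]%classic)
      (c * (2 * M) ^+ n)%:E)%E.
  rewrite [leRHS]integral_mkcond; apply: le_lower_integral => t _.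
    exact: iter_integral_ge0.
  rewrite /patch; case: ifPn => tM.
    apply: IH => // y; apply: le_trans (gc _) _; rewrite box_row_mx.
    by case: (`|t| <= M) => //=; case: ifP; rewrite lee_fin.
  have [n0 n1] : iter_integral n (fun _ => 0%E) = 0%E :> \bar R /\ True.
    split => //; elim: (n) => [|k IHk] //=.
    by under eq_integral do rewrite IHk; rewrite integral0.
  rewrite -[leRHS]n0; apply: le_iter_integral => // y.
  apply: le_trans (gc _) _; rewrite box_row_mx ler_norml.
  move: tM; rewrite notin_setE /= in_itv /= => /negP /negbTE ->.
  by [].
apply: le_trans step _; rewrite integral_cst//= lebesgue_measure_itv/= lte_fin.
case: ifPn => MM; rewrite ?mule0 ?lee_fin.
  by rewrite opprK exprSr mulrA -mulr2n mulr_natl.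
by rewrite mulr_ge0// exprn_ge0// mulr_ge0.
Qed.

End iterated_lower_integral.

(** * Kinks of convex functions *)

Section chords.
Context {R : realType}.

(** Convexity on the line without denominators, so that the degenerate cases
    [a = b] and [b = c] are harmless. *)
Definition chord_convex (g : R -> R) : Prop :=
  forall a b c, a <= b -> b <= c -> (c - a) * g b <= (c - b) * g a + (b - a) * g c.

Lemma chord_lower (g : R -> R) a b c : chord_convex g -> a < b -> b < c ->
  (g b - g a) / (b - a) <= (g c - g a) / (c - a).
Proof.
move=> cg ab bc; have := cg a b c (ltW ab) (ltW bc).
have ac : a < c by exact: lt_trans bc.
rewrite ler_pdivrMr ?subr_gt0// mulrAC ler_pdivlMr ?subr_gt0//; lra.
Qed.

Lemma chord_upper (g : R -> R) a b c : chord_convex g -> a < b -> b < c ->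
  (g c - g a) / (c - a) <= (g c - g b) / (c - b).
Proof.
move=> cg ab bc; have := cg a b c (ltW ab) (ltW bc).
have ac : a < c by exact: lt_trans bc.
rewrite ler_pdivrMr ?subr_gt0// mulrAC ler_pdivlMr ?subr_gt0//; lra.
Qed.

(** For a convex [g] the second differences at [s], divided by the step,
    decrease to the jump of the derivative at [s], so these are the points
    where the jump is at least [eps].  The inequalities for all [k], rather
    than the limit, make the set closed. *)
Definition kink1 (g : R -> R) (eps : R) : set R :=
  [set s | forall k, eps / k.+1%:R
    <= g (s + k.+1%:R^-1) + g (s - k.+1%:R^-1) - 2 * g s].

Definition right_slope (g : R -> R) (s : R) : R :=
  inf [set (g u - g s) / (u - s) | u in [set u | s < u]].

(** The right slope is a nondecreasing function of the point with values in
    [[- L, L]], and it increases by at least [eps] from one kink to the next.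
    Hence rounding [(right_slope + L) / eps] down is injective on kinks and
    takes at most [2 L / eps + 1] values. *)
Lemma kink1_card (g : R -> R) (L eps : R) (s : seq R) : 0 < eps ->
  chord_convex g -> (forall a b, `|g a - g b| <= L * `|a - b|) ->
  uniq s -> (forall t, t \in s -> kink1 g eps t) ->
  (size s <= (Num.truncn (2 * L / eps)).+1)%N.
Proof.
move=> eps0 cg Lg us ks.
pose S t := [set (g u - g t) / (u - t) | u in [set u | t < u]].
have S0 t : S t !=set0 by exists ((g (t + 1) - g t) / ((t + 1) - t)); exists (t + 1) => //=; rewrite ltrDl.
have slopeL t u : t < u -> `|(g u - g t) / (u - t)| <= L.
  move=> tu; rewrite normrM normfV ler_pdivrMr; first exact: Lg.
  by rewrite normr_gt0 subr_eq0 gt_eqF.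
have Slb t : has_lbound (S t).
  exists (- L) => _ [u /= tu <-].
  by have := slopeL _ _ tu; rewrite ler_norml => /andP[].
have psi_lb t u : t < u -> right_slope g t <= (g u - g t) / (u - t).
  by move=> tu; apply: ge_inf; [exact: Slb|exists u].
have psiL t : - L <= right_slope g t <= L.
  apply/andP; split.
    apply: lb_le_inf => [|_ [u /= tu <-]]; first exact: S0.
    by have := slopeL _ _ tu; rewrite ler_norml => /andP[].
  have tu : t < t + 1 by rewrite ltrDl.
  apply: le_trans (psi_lb _ _ tu) _.
  by have := slopeL _ _ tu; rewrite ler_norml => /andP[].
have jump t t' : kink1 g eps t' -> t < t' -> right_slope g t + eps <= right_slope g t'.
  move=> kt' tt'; apply: lb_le_inf => [|_ [u /= t'u <-]]; first exact: S0.
  have m0 : 0 < Num.min (t' - t) (u - t') by rewrite lt_min !subr_gt0 tt'.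
  (* a step so short that t < t' - 1 / (k + 1) and t' + 1 / (k + 1) < u *)
  pose k := Num.truncn (Num.min (t' - t) (u - t'))^-1.
  have kP : (k.+1%:R)^-1 < Num.min (t' - t) (u - t').
    rewrite invf_plt ?posrE// ?ltr0n//.
    by rewrite truncnS_gt.
  have e0 : 0 < k.+1%:R^-1 :> R by rewrite invr_gt0 ltr0n.
  move: (kt' k) kP; rewrite lt_min; set e := _^-1 in e0 *; move=> ktk /andP[et eu].
  have h1 : (g (t' + e) - g t') / e <= (g u - g t') / (u - t').
    have := @chord_lower g t' (t' + e) u cg.
    rewrite [t' + e - t']addrAC subrr add0r; apply; lra.
  have h2 : (g t' - g t) / (t' - t) <= (g t' - g (t' - e)) / e.
    have := @chord_upper g t (t' - e) t' cg.
    rewrite (_ : t' - (t' - e) = e); last by lra.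
    by apply; lra.
  have h3 : eps <= (g (t' + e) - g t') / e - (g t' - g (t' - e)) / e.
    by rewrite -mulrBl ler_pdivlMr//; lra.
  by have := psi_lb _ _ tt'; lra.
pose F t := Num.truncn ((right_slope g t + L) / eps).
have Finj : {in s &, injective F}.
  have lt t t' : t \in s -> t' \in s -> t < t' -> (F t < F t')%N.
    move=> ts t's tt'; have J := jump _ _ (ks _ t's) tt'.
    have /andP[pt1 pt2] := psiL t.
    have x0 : 0 <= (right_slope g t + L) / eps by apply: divr_ge0; lra.
    rewrite truncn_ge_nat; last by apply: divr_ge0; lra.
    have Ft : (F t)%:R <= (right_slope g t + L) / eps by rewrite truncn_le.
    rewrite -natr1; apply: (@le_trans _ _ ((right_slope g t + L) / eps + 1)).
      by rewrite lerD2r.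
    by rewrite -{1}(divff (lt0r_neq0 eps0)) -mulrDl ler_pM2r ?invr_gt0//; lra.
  move=> t t' ts t's FF; case: (ltgtP t t') => // tt'.
    by have := lt _ _ ts t's tt'; rewrite FF ltnn.
  by have := lt _ _ t's ts tt'; rewrite FF ltnn.
have -> : size s = size (map F s) by rewrite size_map.
rewrite -(size_iota 0 (Num.truncn (2 * L / eps)).+1).
apply: uniq_leq_size; first by rewrite map_inj_in_uniq.
move=> _ /mapP[t ts ->]; rewrite mem_iota add0n ltnS /=.
apply: le_truncn; rewrite ler_pM2r ?invr_gt0//.
by have := psiL t; lra.
Qed.

End chords.

Section kinks.
Context {R : realType}.

Definition convex_fun n (f : 'rV[R]_n -> R) : Prop := forall x y t, 0 <= t <= 1 ->
  f (t *: x + (1 - t) *: y) <= t * f x + (1 - t) * f y.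

Definition coord_lipschitz n (L : R) (f : 'rV[R]_n -> R) : Prop :=
  forall i y s, `|f (y + s *: delta_mx 0 i) - f y| <= L * `|s|.

Definition kink n (f : 'rV[R]_n -> R) (i : 'I_n) (eps : R) : set 'rV[R]_n :=
  [set y | forall k, eps / k.+1%:R <= f (y + k.+1%:R^-1 *: delta_mx 0 i)
     + f (y - k.+1%:R^-1 *: delta_mx 0 i) - 2 * f y].

Lemma chord_convex_line n (f : 'rV[R]_n -> R) (y v : 'rV[R]_n) :
  convex_fun n f -> chord_convex (fun s => f (y + s *: v)).
Proof.
move=> cf a b c ab bc.
have [ac|] := ltP a c; last first.
  move=> ca; have -> : a = b by apply/eqP; rewrite eq_le ab (le_trans bc).
  have -> : c = b by apply/eqP; rewrite eq_le bc (le_trans ca).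
  by rewrite subrr !mul0r addr0.
have t01 : 0 <= (c - b) / (c - a) <= 1.
  by apply/andP; split; [rewrite divr_ge0 ?subr_ge0 ?(ltW ac)|rewrite ler_pdivrMr ?subr_gt0// mul1r; lra].
have ca0 : c - a != 0 by rewrite subr_eq0 gt_eqF.
have := cf (y + a *: v) (y + c *: v) _ t01.
rewrite (_ : _ *: _ + _ = y + b *: v); last first.
  rewrite !scalerDr addrACA -scalerDl [X in X *: y](_ : _ = 1); last by rewrite addrC subrK.
  rewrite scale1r !scalerA -scalerDl; congr (_ + _ *: _).
  by field.
rewrite -(@ler_pM2l _ (c - a)) ?subr_gt0// => /le_trans; apply.
by rewrite le_eqVlt; apply/orP; left; apply/eqP; field.
Qed.

Lemma row_mx_shiftl n (t s : R) (y : 'rV[R]_n) (i : 'I_n.+1) : i = ord0 ->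
  row_mx (const_mx t : 'rV[R]_1) y + s *: delta_mx 0 i
  = row_mx (const_mx (t + s) : 'rV[R]_1) y.
Proof.
move=> ->; apply/rowP => j; rewrite [LHS]mxE.
case: (@split_ordP 1 n j) => k ->.
  rewrite (row_mxEl (const_mx t : 'rV[R]_1) y) (row_mxEl (const_mx (t + s) : 'rV[R]_1) y).
  by rewrite !mxE (ord1 k) (_ : (_ == _) = true) ?mulr1//; apply/eqP/val_inj.
rewrite (row_mxEr (const_mx t : 'rV[R]_1) y) (row_mxEr (const_mx (t + s) : 'rV[R]_1) y).
by rewrite !mxE (_ : (rshift 1 k == ord0) = false) ?andbF ?mulr0 ?addr0//; apply/negbTE/eqP => /(congr1 val).
Qed.

Lemma row_mx_shiftr n (t s : R) (y : 'rV[R]_n) (i : 'I_n) :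
  row_mx (const_mx t : 'rV[R]_1) y + s *: delta_mx 0 (rshift 1 i)
  = row_mx (const_mx t : 'rV[R]_1) (y + s *: delta_mx 0 i).
Proof.
apply/rowP => j; rewrite [LHS]mxE.
case: (@split_ordP 1 n j) => k ->.
  rewrite !(row_mxEl (const_mx t : 'rV[R]_1)) !mxE.
  by rewrite (_ : (lshift n k == rshift 1 i) = false) ?andbF ?mulr0 ?addr0//; apply/negbTE/eqP => /(congr1 val) /=; rewrite (ord1 k).
rewrite !(row_mxEr (const_mx t : 'rV[R]_1)) !mxE.
by congr (_ + _ * (nat_of_bool _)%:R); apply/eqP/eqP => [/rshift_inj|->].
Qed.

Lemma convex_slice n (f : 'rV[R]_n.+1 -> R) (t : R) : convex_fun n.+1 f ->
  convex_fun n (fun y => f (row_mx (const_mx t : 'rV[R]_1) y)).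
Proof.
move=> cf x y s s01; apply: le_trans (cf _ _ _ s01).
rewrite le_eqVlt; apply/orP; left; apply/eqP; congr f; apply/rowP => j.
rewrite [RHS]mxE [X in _ = X + _]mxE [X in _ = _ + X]mxE.
case: (@split_ordP 1 n j) => k ->.
  by rewrite !(row_mxEl (const_mx t : 'rV[R]_1)) !mxE -mulrDl addrC subrK mul1r.
by rewrite !(row_mxEr (const_mx t : 'rV[R]_1)) !mxE.
Qed.

Lemma lipschitz_slice n L (f : 'rV[R]_n.+1 -> R) (t : R) :
  coord_lipschitz n.+1 L f ->
  coord_lipschitz n L (fun y => f (row_mx (const_mx t : 'rV[R]_1) y)).
Proof. by move=> lf i y s; rewrite -row_mx_shiftr; exact: lf. Qed.

(** Lines in the first coordinate direction are parametrized by the outermost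
    variable of the iterated integral. *)
Lemma kink_slice_card n (f : 'rV[R]_n.+1 -> R) L eps (y : 'rV[R]_n) (s : seq R) :
  0 < eps -> convex_fun n.+1 f -> coord_lipschitz n.+1 L f -> uniq s ->
  (forall t, t \in s -> kink n.+1 f ord0 eps (row_mx (const_mx t : 'rV[R]_1) y)) ->
  (size s <= (Num.truncn (2 * L / eps)).+1)%N.
Proof.
move=> eps0 cf lf us ks.
pose g s := f (row_mx (const_mx s : 'rV[R]_1) y).
have gE : g = fun s => f (row_mx (const_mx 0 : 'rV[R]_1) y + s *: delta_mx 0 ord0).
  by apply/funext => a; rewrite row_mx_shiftl// add0r.
apply: (@kink1_card _ g) => //.
- by rewrite gE; exact: chord_convex_line.
- move=> a b; rewrite /g.
  have := lf ord0 (row_mx (const_mx b : 'rV[R]_1) y) (a - b).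
  by rewrite row_mx_shiftl// [b + _]addrC subrK.
- move=> t /ks H k; have := H k.
  by rewrite -scaleNr !row_mx_shiftl.
Qed.

(** Only finitely many [t] can have [h t > 1 / (m + 1)], since their sum is
    bounded. *)
Lemma countable_finite_sums (h : R -> \bar R) (B : R) :
  (forall t, 0 <= h t)%E ->
  (forall s : seq R, uniq s -> \sum_(t <- s) h t <= B%:E)%E ->
  countable [set t | h t != 0%E].
Proof.
move=> h0 hB.
have -> : [set t | h t != 0%E] = \bigcup_m [set t | (m.+1%:R^-1)%:E < h t]%E.
  apply/seteqP; split => [t /= ht|t [m _ /= mt]]; last first.
    by rewrite gt_eqF// (le_lt_trans _ mt)// lee_fin invr_ge0.
  have {}ht : (0 < h t)%E by rewrite lt_def ht h0.
  case htE : (h t) ht => [r| |//]; last by exists 0%N; rewrite //= htE ltry.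
  rewrite lte_fin => r0; exists (Num.truncn r^-1) => //=.
  rewrite htE lte_fin invf_plt ?posrE//.
  exact: truncnS_gt.
apply: bigcup_countable => // m _; apply: finite_set_countable.
apply: contrapT => /(@infinite_set_fset _ _ (Num.truncn (m.+1%:R * B)).+1) [C CS Csize].
have := hB _ (finmap.fset_uniq C); rewrite leNgt => /negP; apply.
apply: (@lt_le_trans _ _ (\sum_(t <- finmap.enum_fset C) (m.+1%:R^-1)%:E)%E).
  rewrite sumEFin lte_fin big_const_seq count_predT iter_addr_0.
  rewrite -[_ *+ size _]mulr_natl ltr_pdivlMr ?ltr0n// mulrC.
  apply: (lt_le_trans (truncnS_gt _)).
  by rewrite ler_nat.
rewrite big_seq [leRHS]big_seq; apply: lee_sum => t tC.
by apply/ltW/CS.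
Qed.

Lemma integral_countable_support (h : R -> \bar R) :
  (forall t, 0 <= h t)%E -> countable [set t | h t != 0%E] ->
  (\int[@lebesgue_measure R]_t h t)%E = 0%E.
Proof.
move=> h0 ch; set C := [set _ | _] in ch.
have mC : measurable (C : set (measurableTypeR R)).
  by apply: countable_measurable ch => t; exact: measurable_set1.
apply/eqP; rewrite eq_le integral_ge0 ?andbT//.
have : (\int[@lebesgue_measure R]_(t in C) +oo)%E = 0%E.
  by apply: null_set_integral => //; exact: countable_lebesgue_measure0.
move=> <-; rewrite [leRHS]integral_mkcond; apply: le_lower_integral => t _ //.
rewrite /patch; case: ifPn => [_|]; first by rewrite leey.
by rewrite notin_setE /C /= => /negP; rewrite negbK => /eqP ->.
Qed.

(** Induction on the dimension.  If the direction is not the first coordinate,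
    every slice is a set of the same kind in one dimension less.  In the first
    direction, each [y] belongs to at most K of the slices, so by
    superadditivity the measures of finitely many slices add up to at most K
    times the measure of the box; hence all but countably many slices are
    null. *)
Lemma kink_null n (f : 'rV[R]_n -> R) L i eps M (A : set 'rV[R]_n) :
  0 < eps -> 0 <= M -> convex_fun n f -> coord_lipschitz n L f ->
  (forall y, A y -> kink n f i eps y /\ box n M y) ->
  lebesgue_rV (A : set (borelRV R n)) = 0%E.
Proof.
move=> eps0 M0; elim: n f i A => [|n IH] f i A cf lf; first by case: i.
move=> kA.
have [j i0|j ij] := @split_ordP 1 n i; last first.
  apply: integral0_eq => t _.
  apply: (IH _ j _ (convex_slice _ _ t cf) (lipschitz_slice _ _ _ t lf)) => y Ay.
  have [ky] := kA _ Ay; rewrite box_row_mx => /andP[_ By]; split => // k.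
  have := ky k; rewrite ij -!scaleNr !row_mx_shiftr.
  by [].
pose h t : \bar R := lebesgue_rV ([set y | A (row_mx (const_mx t : 'rV[R]_1) y)] : set (borelRV R n)).
have h0 t : (0 <= h t)%E by rewrite /h lebesgue_rVE; exact: iter_integral_ge0.
apply: (@integral_countable_support h h0).
pose K := (Num.truncn (2 * L / eps)).+1.
apply: (@countable_finite_sums _ (K%:R * (2 * M) ^+ n)) => // s us.
under eq_bigr do rewrite /h lebesgue_rVE.
apply: le_trans (iter_integral_sum _ _ _ _ _) _ => //.
apply: iter_integral_box => // y; first by apply: sume_ge0.
rewrite sumEFin lee_fin.
case: ifPn => [By|nBy]; last first.
  rewrite big1// => t _; rewrite indicE memNset// => Ay.
  have [_] := kA _ Ay; rewrite box_row_mx => /andP[_] By.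
  by rewrite By in nBy.
pose p t := `[< A (row_mx (const_mx t : 'rV[R]_1) y) >].
apply: (@le_trans _ _ (size [seq t <- s | p t])%:R).
  rewrite size_filter -sum1_count natr_sum [leRHS]big_mkcond /=.
  apply: ler_sum => t _; rewrite indicE /p; case: asboolP => Ay.
    by rewrite mem_set.
  by rewrite memNset.
rewrite ler_nat; apply: (kink_slice_card _ f L eps y) => //.
  exact: filter_uniq.
move=> t; rewrite mem_filter => /andP[/asboolP Ay _].
have [] := kA _ Ay.
rewrite (_ : i = ord0) => //.
by rewrite i0; apply/val_inj; rewrite /= (ord1 j).
Qed.

End kinks.

(** * Fenchel conjugates over a compact set *)

Section dot_product.
Context {R : realType} {d : nat}.
Implicit Types x y : 'rV[R]_d.

Lemma dotDr x y y' : dot x (y + y') = dot x y + dot x y'.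
Proof. by rewrite /dot -big_split; apply: eq_bigr => i _; rewrite !mxE mulrDr. Qed.

Lemma dotDl x x' y : dot (x + x') y = dot x y + dot x' y.
Proof. by rewrite /dot -big_split; apply: eq_bigr => i _; rewrite !mxE mulrDl. Qed.

Lemma dotZr x y a : dot x (a *: y) = a * dot x y.
Proof. by rewrite /dot mulr_sumr; apply: eq_bigr => i _; rewrite !mxE; ring. Qed.

Lemma dotZl x y a : dot (a *: x) y = a * dot x y.
Proof. by rewrite /dot mulr_sumr; apply: eq_bigr => i _; rewrite !mxE; ring. Qed.

Lemma dot_delta x i : dot x (delta_mx 0 i) = x 0 i.
Proof.
rewrite /dot (bigD1 i)//= big1 => [|j ji]; rewrite !mxE ?eqxx ?mulr1 ?addr0//.
by rewrite (negbTE ji) mulr0.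
Qed.

Lemma q_conv x y t : q (t *: x + (1 - t) *: y)
  = t * q x + (1 - t) * q y - t * (1 - t) / 2 * sqnorm (x - y).
Proof.
rewrite /q /sqnorm /dot !mulr_suml !mulr_sumr -!big_split -sumrB /=.
by apply: eq_bigr => i _; rewrite !mxE; field.
Qed.

Lemma sqnorm_ge0 x : 0 <= sqnorm x.
Proof. by apply: sumr_ge0 => i _; rewrite -expr2 sqr_ge0. Qed.

Lemma continuous_dotl y : continuous (fun x => dot x y).
Proof.
apply: (@continuous_big _ _ +%R 0).
  exact: add_continuous.
by move=> i _ x; apply: continuousM; [exact: coord_continuous|exact: cst_continuous].
Qed.

Lemma continuous_q : continuous (@q R d).
Proof.
move=> x; apply: continuousM; last exact: cst_continuous.
move: x; apply: (@continuous_big _ _ +%R 0).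
  exact: add_continuous.
by move=> i _ x; apply: continuousM; exact: coord_continuous.
Qed.

End dot_product.

Section within_continuous.
Context {R : realType} {T : topologicalType} (X : set T).
Implicit Types f g : T -> R.

Lemma within_continuousB f g : {within X, continuous f} -> {within X, continuous g} ->
  {within X, continuous (fun x => f x - g x)}.
Proof.
by move=> cf cg x; exact: (@continuousB R R^o (subspace X) f g x (cf x) (cg x)).
Qed.

Lemma within_continuousD f g : {within X, continuous f} -> {within X, continuous g} ->
  {within X, continuous (fun x => f x + g x)}.
Proof.
by move=> cf cg x; exact: (@continuousD R R^o (subspace X) f g x (cf x) (cg x)).
Qed.

Lemma within_continuousZ (a : R) f : {within X, continuous f} ->
  {within X, continuous (fun x => a * f x)}.
Proof.
move=> cf x; apply: (@continuousM R (subspace X) (cst a) f x _ (cf x)).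
exact: cst_continuous.
Qed.

End within_continuous.

Section fenchel_conjugate.
Context {R : realType} {d : nat} (X : set 'rV[R]_d).
Hypotheses (cX : compact X) (X0 : X !=set0).
Implicit Types (z : 'rV[R]_d -> R) (x y : 'rV[R]_d).

Lemma fenchel_max z y : {within X, continuous z} ->
  exists2 x, X x & fenchel X z y = dot x y - z x /\
    forall x', X x' -> dot x' y - z x' <= fenchel X z y.
Proof.
move=> cz.
have cg : {within X, continuous (fun x => dot x y - z x)}.
  apply: within_continuousB => //.
  exact: (continuous_subspaceT (continuous_dotl y)).
have [x /set_mem Xx xmax] := compact_EVT_max X0 cX cg.
have ub : ubound [set dot x y - z x | x in X] (dot x y - z x).
  by move=> _ [x' Xx' <-]; apply: xmax; rewrite inE.
have E : fenchel X z y = dot x y - z x.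
  apply/eqP; rewrite eq_le; apply/andP; split.
    by apply: ge_sup => //; exists (dot x y - z x); exists x.
  by apply: ub_le_sup; [exists (dot x y - z x)|exists x].
exists x => //; split => // x' Xx'; rewrite E; apply: xmax; by rewrite inE.
Qed.

Lemma le_fenchel z x y : {within X, continuous z} -> X x ->
  dot x y - z x <= fenchel X z y.
Proof. by move=> cz Xx; have [_ _ [_]] := fenchel_max _ y cz; exact. Qed.

Lemma fenchel_le z y c : (forall x, X x -> dot x y - z x <= c) ->
  fenchel X z y <= c.
Proof.
move=> H; have [x Xx] := X0; apply: ge_sup; first by exists (dot x y - z x); exists x.
by move=> _ [x' Xx' <-]; exact: H.
Qed.

Lemma fenchel_convex z : {within X, continuous z} -> convex_fun d (fenchel X z).
Proof.
move=> cz y y' t /andP[t0 t1]; apply: fenchel_le => x Xx.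
have := le_fenchel _ _ y cz Xx; have := le_fenchel _ _ y' cz Xx.
rewrite dotDr !dotZr => h1 h2.
have := ler_wpM2l t0 h2; have := @ler_wpM2l _ (1 - t) _ _ _ h1.
by rewrite subr_ge0 => /(_ t1); lra.
Qed.

Lemma fenchel_conv z z' y t : {within X, continuous z} -> {within X, continuous z'} ->
  0 <= t <= 1 ->
  fenchel X (fun x => t * z x + (1 - t) * z' x) y
    <= t * fenchel X z y + (1 - t) * fenchel X z' y.
Proof.
move=> cz cz' /andP[t0 t1]; apply: fenchel_le => x Xx.
have := le_fenchel _ _ y cz Xx; have := le_fenchel _ _ y cz' Xx => h1 h2.
have := ler_wpM2l t0 h2; have := @ler_wpM2l _ (1 - t) _ _ _ h1.
by rewrite subr_ge0 => /(_ t1); lra.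
Qed.

(** Moving [y] changes each of the affine functions whose supremum is the
    conjugate by at most [L] times the l^1 distance. *)
Lemma fenchel_dist z (L : R) y y' : {within X, continuous z} ->
  (forall x i, X x -> `|x 0 i| <= L) ->
  fenchel X z y <= fenchel X z y' + L * \sum_i `|(y - y') 0 i|.
Proof.
move=> cz XL; apply: fenchel_le => x Xx.
have := le_fenchel _ _ y' cz Xx.
have -> : dot x y = dot x y' + dot x (y - y') by rewrite -dotDr addrC subrK.
have : dot x (y - y') <= L * \sum_i `|(y - y') 0 i|.
  rewrite mulr_sumr; apply: ler_sum => i _; apply: le_trans (ler_norm _) _.
  by rewrite normrM ler_wpM2r//; exact: XL.
lra.
Qed.

Lemma fenchel_coord_lipschitz z (L : R) : {within X, continuous z} ->
  (forall x i, X x -> `|x 0 i| <= L) -> coord_lipschitz d L (fenchel X z).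
Proof.
move=> cz XL i y s.
have sumE (a : R) : \sum_j `|(a *: delta_mx 0 i : 'rV[R]_d) 0 j| = `|a|.
  rewrite (bigD1 i)//= big1 => [|j ji]; rewrite !mxE ?eqxx ?mulr1 ?addr0//.
  by rewrite (negbTE ji) mulr0 normr0.
have h1 := @fenchel_dist z L (y + s *: delta_mx 0 i) y cz XL.
have h2 := @fenchel_dist z L y (y + s *: delta_mx 0 i) cz XL.
move: h1 h2; rewrite [y + _ - y]addrAC subrr add0r sumE opprD addrA subrr add0r -scaleNr sumE normrN.
by move=> h1 h2; rewrite ler_norml; lra.
Qed.

Lemma fenchel_continuous z (L : R) : {within X, continuous z} ->
  (forall x i, X x -> `|x 0 i| <= L) -> continuous (fenchel X z).
Proof.
move=> cz XL y; apply: (iffRL (@cvgrPdist_le R R^o _ (nbhs y) _ _ _)) => e e0.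
have cS : continuous (fun y' : 'rV[R]_d => \sum_i `|y 0 i - y' 0 i|).
  apply: (@continuous_big _ _ +%R 0); first exact: add_continuous.
  move=> i _ y'; apply: (@continuous_comp _ _ _ (fun y' : 'rV[R]_d => y 0 i - y' 0 i) Num.norm).
    by apply: (@continuousB R R^o _ (cst (y 0 i))); [exact: cst_continuous|exact: coord_continuous].
  exact: norm_continuous.
have cL : {for y, continuous (cst L : 'rV[R]_d -> R)} by exact: cst_continuous.
have := @continuousM R _ (cst L) _ y cL (cS y).
move/(iffLR (@cvgrPdist_le R R^o _ (nbhs y) _ _ _)) => /(_ _ e0); apply: filterS => y' /=.
rewrite [X in L * X - _]big1 => [|i _]; last by rewrite subrr normr0.
rewrite mulr0 sub0r normrN => He.
have h1 := @fenchel_dist z L y y' cz XL.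
have h2 := @fenchel_dist z L y' y cz XL.
have E : \sum_i `|(y' - y) 0 i| = \sum_i `|(y - y') 0 i|.
  by apply: eq_bigr => i _; rewrite -opprB mxE normrN.
have E' : \sum_i `|(y - y') 0 i| = \sum_i `|y 0 i - y' 0 i|.
  by apply: eq_bigr => i _; rewrite !mxE.
rewrite E E' in h2; rewrite E' in h1.
have := le_trans (ler_norm _) He => H.
by rewrite ler_norml; lra.
Qed.

Lemma compact_coord_bound : exists2 L : R, 0 <= L & forall x i, X x -> `|x 0 i| <= L.
Proof.
have /ex_strict_bound_gt0[L L0 HL] := compact_bounded cX.
exists L; first exact: ltW.
move=> x i Xx; apply: le_trans (ltW (HL _ Xx)).
have -> : `|x| = mx_norm x by [].
by rewrite mx_normrE; exact: (le_bigmax _ (fun ij => `|x ij.1 ij.2|) (0, i)).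
Qed.

End fenchel_conjugate.

(** * First-order behaviour of conjugates *)

Section first_order.
Context {R : realType} {d : nat}.
Implicit Types (x y : 'rV[R]_d) (z : 'rV[R]_d -> R).

(** For convex [f]: all partial derivatives exist at [y]. *)
Definition smooth_point (f : 'rV[R]_d -> R) (y : 'rV[R]_d) : Prop :=
  forall i eps, 0 < eps -> ~ kink d f i eps y.

(** Subtracting the affine minorant leaves a nonnegative convex function on
    the line that vanishes at 0.  Where there is no kink of size [eps], its
    values at [1 / k] and [- 1 / k] sum to less than [eps / k], and convexity
    propagates this to all smaller increments. *)
Lemma subgradient_is_derive (f : 'rV[R]_d -> R) x y i : convex_fun d f ->
  smooth_point f y -> (forall u, f y + dot x (u - y) <= f u) ->
  is_derive y (delta_mx 0 i) f (x 0 i).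
Proof.
move=> cf sy subg.
set e := delta_mx 0 i.
pose g s := f (y + s *: e).
have cg : chord_convex g by exact: chord_convex_line.
have g0 : g 0 = f y by rewrite /g scale0r addr0.
have gsub s : g 0 + s * x 0 i <= g s.
  by have := subg (y + s *: e); rewrite addrAC subrr add0r dotZr dot_delta g0.
have main : h^-1 *: ((f \o shift y) (h *: e) - f y) @[h --> 0^'] --> (x 0 i : R^o).
  apply/cvgrPdist_le => eps eps0.
  have /existsNP [k /negP] := sy i eps eps0.
  rewrite -ltNge -scaleNr -[f (y + _)]/(g _) -[f (y + (- _) *: _)]/(g _) -g0.
  have k0 : 0 < k.+1%:R^-1 :> R by rewrite invr_gt0 ltr0n.
  set t := k.+1%:R^-1 in k0 *; move=> kt.
  have /(_ _ k0) := @dnbhs0_lt R R^o.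
  have := @nbhs_dnbhs_neq R^o 0.
  apply: filterS2 => h /= h0 ht.
  rewrite (_ : f (h *: e + y) = g h); last by rewrite /g [h *: e + y]addrC.
  rewrite -[_ *: _]/(_ * _).
  have gt := gsub t; have gnt := gsub (- t).
  move: ht; rewrite ltr_norml => /andP[ht1 ht2].
  have [hpos|hneg] : 0 < h \/ h < 0 by case: (ltgtP h 0) h0 => //; [right|left].
    have b1 : x 0 i <= h^-1 * (g h - g 0).
      by rewrite ler_pdivlMl//; have := gsub h; lra.
    have := @chord_lower _ g 0 h t cg hpos ht2; rewrite !subr0 [_ / h]mulrC => b2.
    have b3 : (g t - g 0) / t <= x 0 i + eps.
      by rewrite ler_pdivrMr//; lra.
    by rewrite ler_norml; lra.
  have b1 : h^-1 * (g h - g 0) <= x 0 i.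
    by rewrite ler_ndivrMl//; have := gsub h; lra.
  have := @chord_upper _ g (- t) h 0 cg ht1 hneg.
  rewrite !sub0r opprK => b2.
  have b3 : x 0 i - eps <= (g 0 - g (- t)) / t.
    by rewrite ler_pdivlMr//; lra.
  have b4 : (g 0 - g h) / - h = h^-1 * (g h - g 0) by field.
  rewrite b4 in b2.
  by rewrite ler_norml; lra.
by apply: DeriveDef; [apply/cvg_ex; exists (x 0 i)|exact: cvg_lim].
Qed.

Lemma smooth_subgradient_unique (f : 'rV[R]_d -> R) x x' y : convex_fun d f ->
  smooth_point f y -> (forall u, f y + dot x (u - y) <= f u) ->
  (forall u, f y + dot x' (u - y) <= f u) -> x = x'.
Proof.
move=> cf sy hx hx'; apply/rowP => i.
have D1 := subgradient_is_derive _ _ _ i cf sy hx.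
have D2 := subgradient_is_derive _ _ _ i cf sy hx'.
exact: etrans (esym (@derive_val _ _ _ _ _ _ _ D1)) (@derive_val _ _ _ _ _ _ _ D2).
Qed.

Lemma maximizer_subgradient (X : set 'rV[R]_d) z x y : compact X -> X x ->
  {within X, continuous z} -> fenchel X z y = dot x y - z x ->
  forall u, fenchel X z y + dot x (u - y) <= fenchel X z u.
Proof.
move=> cX Xx cz E u.
have X0 : X !=set0 by exists x.
have := le_fenchel X cX X0 _ _ u cz Xx.
have : dot x u = dot x y + dot x (u - y) by rewrite -dotDr addrC subrK.
by rewrite E; lra.
Qed.

Lemma grad_fenchelB (X : set 'rV[R]_d) z z' x x' y : compact X -> X x -> X x' ->
  {within X, continuous z} -> {within X, continuous z'} ->
  fenchel X z y = dot x y - z x -> fenchel X z' y = dot x' y - z' x' ->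
  smooth_point (fenchel X z) y -> smooth_point (fenchel X z') y ->
  grad (fun u => fenchel X z u - fenchel X z' u) y = x - x'.
Proof.
move=> cX Xx Xx' cz cz' Ez Ez' sz sz'; apply/rowP => i; rewrite !mxE.
have X0 : X !=set0 by exists x.
have d1 := subgradient_is_derive _ _ _ i (fenchel_convex X cX X0 _ cz) sz
  (maximizer_subgradient X z x y cX Xx cz Ez).
have d2 := subgradient_is_derive _ _ _ i (fenchel_convex X cX X0 _ cz') sz'
  (maximizer_subgradient X z' x' y cX Xx' cz' Ez').
exact: (@derive_val _ _ _ _ _ _ _ (is_deriveB d1 d2)).
Qed.

Lemma compact_within_preimage (X : set 'rV[R]_d) (f : 'rV[R]_d -> R) (C : set R) :
  compact X -> {within X, continuous f} -> closed C -> compact (X `&` f @^-1` C).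
Proof.
move=> cX cf cC.
have : closed (f @^-1` C : set (subspace X)) by move/continuous_closedP : cf => /(_ C cC).
move=> /closed_subspaceP[V cV VE].
have -> : X `&` f @^-1` C = X `&` V by rewrite setIC -VE setIC.
exact: compact_closedI.
Qed.

(** Upper half of the envelope theorem.  Where [h > h x - eps] the
    perturbation lowers the objective by the stated amount; the remaining
    points form a compact set that avoids the unique maximizer, so the
    unperturbed objective stays away from its maximum there and a small
    perturbation cannot make up for it. *)
Lemma danskin (X : set 'rV[R]_d) (z h : 'rV[R]_d -> R) x y (eps : R) : compact X -> X x ->
  {within X, continuous z} -> {within X, continuous h} ->
  (forall x', X x' -> dot x' y - z x' = fenchel X z y -> x' = x) -> 0 < eps ->
  exists2 t0 : R, 0 < t0 & forall t, 0 < t <= t0 ->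
    fenchel X (fun u => z u + t * h u) y <= fenchel X z y - t * (h x - eps).
Proof.
move=> cX Xx cz ch uniq eps0.
have X0 : X !=set0 by exists x.
(* the points where the perturbation lowers the objective too little *)
pose K := X `&` h @^-1` [set r | r <= h x - eps].
have cK : compact K by apply: compact_within_preimage => //; exact: closed_le.
have KX : K `<=` X by move=> ? [].
have outside t x' : 0 < t -> X x' -> ~ K x' ->
    dot x' y - (z x' + t * h x') <= fenchel X z y - t * (h x - eps).
  move=> t0 Xx' nK; have := le_fenchel X cX X0 _ _ y cz Xx'.
  have : h x - eps < h x' by rewrite ltNge; apply/negP => H; apply: nK.
  by rewrite -(ltr_pM2l t0); lra.
have [K0|] := pselect (K !=set0); last first.
  move=> K0; exists 1 => // t /andP[t0 _]; apply: fenchel_le => // x' Xx'.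
  by apply: outside => // Kx'; apply: K0; exists x'.
have cg : {within K, continuous (fun u => dot u y - z u)}.
  apply: (continuous_subspaceW KX); apply: within_continuousB => //.
  exact: (continuous_subspaceT (continuous_dotl y)).
have [k /set_mem [Xk hk] kmax] := compact_EVT_max K0 cK cg.
have [kmin /set_mem _ hmin] := compact_EVT_min K0 cK (continuous_subspaceW KX ch).
have gap : dot k y - z k < fenchel X z y.
  rewrite lt_neqAle (le_fenchel X)// andbT; apply/eqP => E.
  by have := uniq _ Xk E => kx; move: hk; rewrite /= kx; lra.
set D := fenchel X z y - (dot k y - z k).
have D0 : 0 < D by rewrite subr_gt0.
pose B := `|h x - eps - h kmin| + 1.
have B0 : 0 < B by rewrite ltr_pwDr.
exists (D / B); first exact: divr_gt0.
move=> t /andP[t0]; rewrite ler_pdivlMr// => tD.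
apply: fenchel_le => // x' Xx'.
have [Kx'|] := pselect (K x'); last exact: outside.
have h1 := kmax x' (mem_set Kx'); have h2 := hmin x' (mem_set Kx').
have h3 : t * (h x - eps - h x') <= t * B.
  rewrite ler_pM2l// /B; have := ler_norm (h x - eps - h kmin); lra.
by move: h1; rewrite /D in tD; lra.
Qed.

Lemma le_of_scaled (a b : R) : (forall t, 0 < t < 1 -> (1 - t) * a <= b) -> a <= b.
Proof.
move=> H; apply/ler_addgt0Pl => e e0.
have a0 := normr_ge0 a; have ea0 : 0 < e + `|a| by lra.
pose t := Num.min (1 / 2) (e / (e + `|a|)).
have t0 : 0 < t by rewrite lt_min !divr_gt0.
have t1 : t <= 1 / 2 by rewrite ge_min lexx.
have te : t * (e + `|a|) <= e by rewrite -ler_pdivlMr// ge_min lexx orbT.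
have h1 : t * a <= t * `|a| by rewrite ler_pM2l// ler_norm.
have h2 : 0 <= t * e by rewrite mulr_ge0// ltW.
have t01 : 0 < t < 1 by rewrite t0 /=; lra.
have := H t t01; lra.
Qed.

Lemma convex_onP (X : set 'rV[R]_d) z : convex_on X z ->
  (forall x y t, X x -> X y -> 0 <= t <= 1 -> X (t *: x + (1 - t) *: y)) /\
  (forall x y t, X x -> X y -> 0 <= t <= 1 ->
     z (t *: x + (1 - t) *: y) <= t * z x + (1 - t) * z y).
Proof.
move=> [cX cz]; split => x y t Xx Xy /andP[t0 t1].
  by have := cX x y (Itv01 t0 t1) (mem_set Xx) (mem_set Xy) => /set_mem.
by have := cz (Itv01 t0 t1) x y (mem_set Xx) (mem_set Xy).
Qed.

(** [x1] minimizes the strongly convex function [z - <., y>]; compare it with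
    the points of the segment from [x1] to [x] that are close to [x1]. *)
Lemma strongly_convex_gap (X : set 'rV[R]_d) lambda z x x1 y : compact X ->
  {within X, continuous z} -> strongly_convex_on X lambda z -> X x -> X x1 ->
  fenchel X z y = dot x1 y - z x1 ->
  lambda / 2 * sqnorm (x - x1) <= fenchel X z y + z x - dot x y.
Proof.
move=> cX cz /convex_onP[Xc zc] Xx Xx1 E.
apply: le_of_scaled => t /andP[t0 t1].
have t01 : 0 <= t <= 1 by rewrite !ltW.
have X0 : X !=set0 by exists x.
have := le_fenchel X cX X0 _ _ y cz (Xc _ _ _ Xx Xx1 t01).
have := zc _ _ _ Xx Xx1 t01; rewrite q_conv dotDl !dotZl E => h1 h2.
by rewrite -(ler_pM2l t0); lra.
Qed.

Lemma kink_closed (f : 'rV[R]_d -> R) i eps : continuous f -> closed (kink d f i eps).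
Proof.
move=> cf.
have -> : kink d f i eps = \bigcap_k [set y | eps / k.+1%:R
    <= f (y + k.+1%:R^-1 *: delta_mx 0 i) + f (y - k.+1%:R^-1 *: delta_mx 0 i) - 2 * f y].
  by apply/seteqP; split => [y Hy k _|y Hy k]; [exact: Hy|exact: Hy k I].
apply: closed_bigI => k _.
pose G y := f (y + k.+1%:R^-1 *: delta_mx 0 i) + f (y - k.+1%:R^-1 *: delta_mx 0 i) - 2 * f y.
have shiftc (v : 'rV[R]_d) : continuous (fun y => f (y + v)).
  move=> y; apply: (@continuous_comp _ _ _ (fun y => y + v) f); last exact: cf.
  by apply: (@continuousD R _ _ id (cst v)); [exact: cvg_id|exact: cst_continuous].
have cG : continuous G.
  move=> y; apply: (@continuousB R R^o _ (fun y => f (y + _) + f (y - _)) (fun y => 2 * f y)).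
    by apply: (@continuousD R R^o); exact: shiftc.
  by apply: (@continuousM R _ (cst 2) f); [exact: cst_continuous|exact: cf].
move/continuous_closedP : cG => /(_ [set r | eps / k.+1%:R <= r]); apply.
exact: closed_ge.
Qed.

End first_order.

(** * The Legendre transform of an entropy *)

Section legendre_transform.
Context {R : realType} (phi : R -> \bar R).
Hypothesis phiE : entropy_function phi.

Lemma legendre_mono s s' : s <= s' -> (legendre phi s <= legendre phi s')%E.
Proof.
move=> ss'; apply: ge_ereal_sup => _ [r /= r0 <-].
apply: (@le_trans _ _ ((r * s')%:E - phi r)%E).
  by apply: leeD2r; rewrite lee_fin ler_wpM2l.
by apply: ereal_sup_ubound; exists r.
Qed.

Lemma legendre_ge s : (s%:E <= legendre phi s)%E.
Proof.
have [_ _ _ phi1] := phiE.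
apply: ereal_sup_ubound; exists 1 => /=; first exact: ler01.
by rewrite phi1 mul1r sube0.
Qed.

(** The terms of the supremum with [phi r] finite are affine in the argument;
    the others are identically -oo. *)
Lemma legendre_convex s s' t : 0 <= t <= 1 ->
  (legendre phi (t * s + (1 - t) * s')%R
    <= t%:E * legendre phi s + (1 - t)%R%:E * legendre phi s')%E.
Proof.
move=> /andP[t0 t1]; have [phi0 _ _ _] := phiE.
apply: ge_ereal_sup => _ [r /= r0 <-].
have := phi0 _ r0; case phir : (phi r) => [p| |] // _; last by rewrite leNye.
apply: (@le_trans _ _ (t%:E * (r * s - p)%:E + (1 - t)%R%:E * (r * s' - p)%:E)%E).
  by rewrite -EFinB -!EFinM -EFinD lee_fin le_eqVlt; apply/orP; left; apply/eqP; ring.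
apply: leeD; apply: lee_wpmul2l; rewrite ?lee_fin ?subr_ge0//.
  by apply: ereal_sup_ubound; exists r => //; rewrite phir.
by apply: ereal_sup_ubound; exists r => //; rewrite phir.
Qed.

Lemma legendre_measurable : measurable_fun setT (legendre phi).
Proof.
apply: (measurability _ (ErealGenOInfty.measurableE R)) => //.
move=> /= _ [_ [a ->]] <-; apply: measurableI => //.
apply: is_interval_measurable => s t /=.
rewrite !in_itv /= !andbT => fs ft u /andP[su ut].
by rewrite in_itv /= andbT (lt_le_trans fs)// legendre_mono.
Qed.

End legendre_transform.

Section finite_legendre.
Context {R : realType} (phi : R -> \bar R).
Hypotheses (phiE : entropy_function phi)
  (phifin : forall s, legendre phi s \is a fin_num).
Let phis s := fine (legendre phi s).

Lemma phis_mono s s' : s <= s' -> phis s <= phis s'.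
Proof. by move=> ss'; rewrite fine_le// legendre_mono. Qed.

Lemma phis_convex s s' t : 0 <= t <= 1 ->
  phis (t * s + (1 - t) * s') <= t * phis s + (1 - t) * phis s'.
Proof.
move=> t01; have := legendre_convex phi phiE s s' t t01.
by rewrite -(fineK (phifin s)) -(fineK (phifin s')) -(fineK (phifin (_ + _))).
Qed.

End finite_legendre.

Section derivable_convex.
Context {R : realType} (f : R -> R).
Hypothesis df : forall s, derivable f s 1.

Lemma derivable_expansion a eps : 0 < eps ->
  exists2 del, 0 < del & forall h, `|h| < del ->
    `|f (a + h) - f a - h * derive1 f a| <= eps * `|h|.
Proof.
move=> eps0.
have cv : h^-1 *: ((f \o shift a) (h *: (1 : R^o)) - f a) @[h --> 0^'] --> (derive1 f a : R^o).
  by rewrite derive1E; exact: (df a).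
move/cvgrPdist_le : cv => /(_ _ eps0).
move=> /nbhs_ballP[del /= del0 H].
exists del => // h hdel.
have [->|h0] := eqVneq h 0.
  by rewrite addr0 subrr mul0r subrr normr0 mulr0.
have := H h; rewrite /ball /= sub0r normrN => /(_ hdel h0).
rewrite -[h *: 1]/(h * 1) mulr1 -[_ *: _]/(_ * _) -(@ler_pM2r _ `|h|) ?normr_gt0// -normrM.
by rewrite mulrBl mulrAC mulVf// mul1r [h + a]addrC -normrN opprB [_ * h]mulrC.
Qed.

Lemma derivable_derive1_ge0 a : (forall s s', s <= s' -> f s <= f s') -> 0 <= derive1 f a.
Proof.
move=> mf; apply/ler_addgt0Pl => e e0.
have [del del0 H] := derivable_expansion a e e0.
have h0 : 0 < del / 2 by rewrite divr_gt0.
have hd : `|del / 2| < del by rewrite gtr0_norm// gtr_pMr// invf_lt1// ltr1n.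
have := H _ hd; have := mf a (a + del / 2).
rewrite lerDl ltW// => /(_ isT) m.
rewrite (gtr0_norm h0) ler_norml => /andP[h1 h2].
by rewrite -(pmulr_rge0 _ h0); lra.
Qed.

Lemma derivable_continuous : continuous f.
Proof.
by move=> x; apply: differentiable_continuous; apply/derivable1_diffP.
Qed.

(** Strong convexity bounds the chord slope at [a] towards [b] over
    arbitrarily short segments, and these slopes tend to the derivative.  The
    factor [1 - eta] keeps the quadratic gain away from the limit. *)
Lemma strong_tangent_bound (K : set R) alpha a b :
  (forall s s' t, K s -> K s' -> 0 <= t <= 1 ->
    f (t * s + (1 - t) * s') <= t * f s + (1 - t) * f s' - alpha / 2 * (t * (1 - t)) * (s - s') ^+ 2) ->
  0 <= alpha -> K a -> K b ->
  derive1 f a * (b - a) + alpha / 2 * (b - a) ^+ 2 <= f b - f a.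
Proof.
move=> cf alpha0 Ka Kb.
suff H : alpha / 2 * (b - a) ^+ 2 <= f b - f a - derive1 f a * (b - a) by lra.
apply: le_of_scaled => eta /andP[eta0 eta1].
apply/ler_addgt0Pl => e e0.
set w := b - a.
have w1 : 0 < `|w| + 1 by rewrite ltr_wpDl.
have [del del0 H] := derivable_expansion a (e / (`|w| + 1)) (divr_gt0 e0 w1).
pose t := Num.min eta (del / (`|w| + 1)) / 2.
have m0 : 0 < Num.min eta (del / (`|w| + 1)) by rewrite lt_min eta0 divr_gt0.
have t0 : 0 < t by rewrite divr_gt0.
have tm : t < Num.min eta (del / (`|w| + 1)) by rewrite gtr_pMr// invf_lt1// ltr1n.
move: tm; rewrite lt_min => /andP[teta tdel].
have tw : `|t * w| < del.
  rewrite normrM (gtr0_norm t0).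
  apply: (@le_lt_trans _ _ (t * (`|w| + 1))); first by rewrite ler_pM2l// lerDl.
  by rewrite -ltr_pdivlMr.
have t01 : 0 <= t <= 1 by rewrite !ltW//; exact: lt_trans eta1.
have := cf _ _ _ Kb Ka t01.
rewrite (_ : t * b + _ = a + t * w); last by rewrite /w; ring.
have := H _ tw; rewrite ler_norml => /andP[h1 _] h2.
have h3 : e / (`|w| + 1) * `|t * w| <= t * e.
  rewrite normrM (gtr0_norm t0) mulrCA ler_pM2l// mulrAC ler_pdivrMr// ler_pM2l//.
  by rewrite lerDl.
have h4 : t * ((1 - t) * (alpha / 2 * w ^+ 2)) <= t * (f b - f a - derive1 f a * w + e).
  by rewrite -/w in h2; lra.
rewrite ler_pM2l// in h4.
have : (1 - eta) * (alpha / 2 * w ^+ 2) <= (1 - t) * (alpha / 2 * w ^+ 2); last by lra.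
by apply: ler_wpM2r; [rewrite mulr_ge0 ?divr_ge0 ?sqr_ge0|lra].
Qed.

End derivable_convex.

(** * Measure-theoretic tools *)

Section lower_integral_ae.
Context {disp : measure_display} {T : measurableType disp} {R : realType}.
Variable mu : {measure set T -> \bar R}.
Import HBNNSimple.

Lemma lower_integralD_in (D : set T) (f g : T -> \bar R) :
  (forall x, D x -> 0 <= f x)%E -> (forall x, D x -> 0 <= g x)%E ->
  (\int[mu]_(x in D) f x + \int[mu]_(x in D) g x <= \int[mu]_(x in D) (f x + g x))%E.
Proof.
move=> f0 g0; rewrite (integral_mkcond D f) (integral_mkcond D g).
apply: le_trans (lower_integralD mu _ _ _ _) _.
- by move=> x; apply: erestrict_ge0.
- by move=> x; apply: erestrict_ge0.
rewrite [leRHS]integral_mkcond; apply: le_lower_integral => x _.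
  by apply: adde_ge0; apply: erestrict_ge0.
by rewrite /patch; case: ifP => //; rewrite adde0.
Qed.

Lemma lower_integralZ (D : set T) (f : T -> \bar R) (r : R) : 0 <= r ->
  (forall x, D x -> 0 <= f x)%E ->
  (r%:E * \int[mu]_(x in D) f x <= \int[mu]_(x in D) (r%:E * f x))%E.
Proof.
rewrite le_eqVlt => /orP[/eqP <- f0|r0 f0].
  by rewrite mul0e integral_ge0// => x _; rewrite mul0e.
rewrite -lee_pdivlMl// !ge0_integralE//; last first.
  by move=> x Dx; apply: mule_ge0; [rewrite lee_fin ltW|exact: f0].
apply: ge_ereal_sup => _ [h /= hf <-].
rewrite lee_pdivlMl// -sintegralrM; apply: ereal_sup_ubound.
have r0' : 0 <= r by exact: ltW.
exists (mul_nnsfun (cst_nnsfun T (NngNum r0')) h) => // x.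
rewrite /= EFinM; have := hf x; rewrite /patch; case: ifP => _ hx.
  by apply: lee_wpmul2l => //; rewrite lee_fin.
by rewrite -[leRHS](mule0 r%:E); apply: lee_wpmul2l => //; rewrite lee_fin.
Qed.

(** The difficulty is that [f] may fail to be measurable, so the exceptional
    set cannot be cut out of its integral; the larger function is raised to
    +oo there instead. *)
Lemma ae_le_lower_integral (D : set T) (f g : T -> \bar R) : measurable D ->
  (forall x, D x -> 0 <= f x)%E -> (forall x, D x -> 0 <= g x)%E ->
  measurable_fun D g -> {ae mu, forall x, D x -> (f x <= g x)%E} ->
  (\int[mu]_(x in D) f x <= \int[mu]_(x in D) g x)%E.
Proof.
move=> mD f0 g0 mg [N [mN N0 fgN]].
(* adding +oo on the null set N makes the inequality hold everywhere *)
pose H := (cst +oo%E : T -> \bar R) \_ N.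
have H0 : (\int[mu]_(x in D) H x = 0)%E.
  rewrite /H -integral_mkcondr; apply: null_set_integral => //.
    exact: measurableI.
  by apply: (@subset_measure0 _ _ _ mu (D `&` N) N) => //; exact: measurableI.
have mH : measurable_fun D H.
  exact/(measurable_restrict _ mN mD).
rewrite -[leRHS]adde0 -H0 -ge0_integralD//; last first.
  by move=> x Dx; apply: erestrict_ge0 => t _; rewrite /= leey.
apply: le_lower_integral => // x Dx; rewrite /H /patch; case: ifPn => xN.
  by rewrite addey ?leey// gt_eqF// (lt_le_trans _ (g0 _ Dx))// ltNyr.
rewrite adde0; apply: contrapT => nfg; move/negP: xN; apply; rewrite inE.
by apply: fgN => /= /(_ Dx).
Qed.

Lemma measurable_limn_einf (D : set T) (A : (T -> \bar R)^nat) :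
  (forall n, measurable_fun D (A n)) ->
  measurable_fun D (fun x => limn_einf (A^~ x)).
Proof.
move=> mA; apply: (@emeasurable_fun_cvg _ _ _ _ (fun n x => einfs (A^~ x) n)).
  by move=> n; exact: measurable_fun_einfs.
by move=> x _; rewrite limn_einf_lim; exact: is_cvg_einfs.
Qed.

End lower_integral_ae.

Section limn_einf_lemmas.
Context {R : realType}.

Lemma le_limn_einf (u : (\bar R)^nat) (c : \bar R) N :
  (forall n, (N <= n)%N -> (c <= u n)%E) -> (c <= limn_einf u)%E.
Proof.
move=> H; rewrite limn_einf_lim (cvg_lim _ (@cvg_einfs_sup _ u))//.
apply: le_trans (ereal_sup_ubound _ : (einfs u N <= _)%E); last by exists N.
by apply: le_ereal_inf_tmp => _ [n /= Nn <-]; exact: H.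
Qed.

Lemma limn_einfD_le (u v : (\bar R)^nat) (c : \bar R) :
  (forall n, 0 <= u n)%E -> (forall n, 0 <= v n)%E ->
  (forall n, (u n + v n <= c)%E) -> (limn_einf u + limn_einf v <= c)%E.
Proof.
move=> u0 v0 H; rewrite !limn_einf_lim !(cvg_lim _ (@cvg_einfs_sup _ _))//.
have e0 w n : (forall n, 0 <= w n)%E -> (0 <= @einfs R w n)%E.
  by move=> w0; apply: le_ereal_inf_tmp => _ [k _ <-].
apply: ereal_supD_le.
- by exists (einfs u 0); exists 0%N.
- by exists (einfs v 0); exists 0%N.
- by move=> _ [n _ <-]; exact: e0.
- by move=> _ [n _ <-]; exact: e0.
move=> _ _ [n _ <-] [m _ <-]; apply: le_trans (H (maxn n m)).
apply: leeD; apply: ereal_inf_lbound; exists (maxn n m) => //=.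
  exact: leq_maxl.
exact: leq_maxr.
Qed.

End limn_einf_lemmas.

Section borel_rV.
Context {R : realType} {d : nat}.
Local Notation T := (borelRV R d).

Lemma open_measurable_rV (U : set 'rV[R]_d) : open U -> measurable (U : set T).
Proof. by move=> oU; apply: sub_sigma_algebra. Qed.

Lemma closed_measurable_rV (C : set 'rV[R]_d) : closed C -> measurable (C : set T).
Proof.
move=> cC; rewrite -[C]setCK; apply: measurableC; apply: open_measurable_rV.
exact: closed_openC.
Qed.

Lemma compact_measurable_rV (C : set 'rV[R]_d) : compact C -> measurable (C : set T).
Proof.
move=> cC; apply: closed_measurable_rV; exact: compact_closed.
Qed.

Lemma within_continuous_measurable (X : set 'rV[R]_d) (f : 'rV[R]_d -> R) :
  compact X -> {within X, continuous f} -> measurable_fun (X : set T) (f : T -> R).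
Proof.
move=> cX cf; apply: (measurability _ (RGenCInfty.measurableE R)) => //.
move=> /= _ [_ [a ->]] <-.
apply: compact_measurable_rV; apply: compact_within_preimage => //.
rewrite (_ : [set` _] = [set x | a <= x]); first exact: closed_ge.
by apply/seteqP; split => x /=; rewrite in_itv /= andbT.
Qed.

Lemma compact_cover_negligible (m : {measure set T -> \bar R}) (K : set 'rV[R]_d) :
  compact K -> (forall x, K x -> exists U, [/\ open U, U x & m U = 0%E]) ->
  m.-negligible (K : set T).
Proof.
move=> cK H.
have /choice[U HU] : forall x, exists U : set 'rV[R]_d, K x -> [/\ open U, U x & m U = 0%E].
  by move=> x; have [/H[U ?]|nK] := pselect (K x); [exists U|exists set0].
have [D' D'K KD'] : finite_subset_cover K U K.
  move: cK; rewrite compact_cover; apply => [i /HU[]//|x Kx]; by exists x => //; case: (HU x Kx).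
apply: (@negligibleS _ T _ m _ _ KD'); rewrite /cover bigcup_fset.
have : {subset finmap.enum_fset D' <= K} by move=> x xD; exact: D'K.
elim: (finmap.enum_fset D') => [|x s IH] sK.
  by rewrite big_nil; exact: negligible_set0.
rewrite big_cons; apply: negligibleU; last by apply: IH => y ys; apply: sK; rewrite inE ys orbT.
have /HU[oU _ U0] : K x by apply/set_mem; apply: sK; rewrite inE eqxx.
by exists (U x); split => //; exact: open_measurable_rV.
Qed.

(** The points of [X] where [|f|] exceeds [M] are a countable union of compact
    sets disjoint from the support, and each of these is covered by finitely
    many null open sets. *)
Lemma ae_bound_supp (m : {measure set T -> \bar R}) (X : set 'rV[R]_d)
    (f : 'rV[R]_d -> R) (M : R) :
  compact X -> {within X, continuous f} ->
  (forall x, supp m x -> `|f x| <= M) -> {ae m, forall x, X x -> `|f x| <= M}.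
Proof.
move=> cX cf fM.
pose K n := X `&` f @^-1` [set r | M + n.+1%:R^-1 <= `|r|].
have nK n : m.-negligible (K n : set T).
  apply: compact_cover_negligible.
    apply: compact_within_preimage => //.
    have : closed ((@Num.norm _ R) @^-1` [set r | M + n.+1%:R^-1 <= r]).
      apply: (iffLR (continuous_closedP _) (@norm_continuous _ _)).
      exact: closed_ge.
    by [].
  move=> x [Xx /= Mx]; have : ~ supp m x.
    by move=> /fM /(le_trans Mx); rewrite gerDl leNgt invr_gt0 ltr0n.
  move=> /existsNP[U /not_implyP[oU /not_implyP[Ux mU]]].
  exists U; split => //; apply/eqP; rewrite eq_le measure_ge0 andbT.
  by rewrite leNgt; apply/negP.
apply: negligibleS (negligible_bigcup nK) => x /= /not_implyP[Xx /negP].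
rewrite -ltNge => Mx.
exists (Num.truncn (`|f x| - M)^-1) => //; split => //=.
rewrite -lerBrDl; apply: ltW; rewrite invf_plt ?posrE ?subr_gt0//.
exact: truncnS_gt.
Qed.

(** A point that is not smooth has a kink of size [1 / (k + 1)] in one of the
    coordinate directions and lies in some box: countably many closed null
    sets cover these points. *)
Lemma ae_smooth_point (m : {measure set T -> \bar R}) (f : 'rV[R]_d -> R) (L : R) :
  m `<< @lebesgue_rV R d -> convex_fun d f -> coord_lipschitz d L f -> continuous f ->
  {ae m, forall y, smooth_point f y}.
Proof.
move=> mL cvf lf cf.
pose B (M : nat) : set 'rV[R]_d := \bigcap_(j in [set: 'I_d]) [set y | `|y 0 j| <= M%:R].
have cB M : closed (B M).
  apply: closed_bigI => j _.
  have cj : continuous (fun y : 'rV[R]_d => `|y 0 j|).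
    move=> y; apply: (@continuous_comp _ _ _ (fun y : 'rV[R]_d => y 0 j) Num.norm).
      exact: coord_continuous.
    exact: norm_continuous.
  move/continuous_closedP : cj => /(_ [set r | r <= M%:R]); apply.
  exact: closed_le.
pose K i k M := kink d f i k.+1%:R^-1 `&` B M.
have K0 i k M : m.-negligible (K i k M : set T).
  have mK : measurable (K i k M : set T).
    apply: measurableI; apply: closed_measurable_rV => //.
    exact: kink_closed.
  exists (K i k M); split => //; apply: (mL (K i k M)) => // A mA AK.
  apply: (@kink_null _ _ f L i k.+1%:R^-1 M%:R) => // y /AK [ky By]; split => //.
  by apply/forallP => j; exact: By.
have : m.-negligible (\bigcup_k \bigcup_M \big[setU/set0]_(i < d) K i k M : set T).
  apply: negligible_bigcup => k; apply: negligible_bigcup => M.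
  apply: (@big_ind _ (fun S : set T => m.-negligible S)) => //.
    exact: negligible_set0.
  exact: negligibleU.
apply: negligibleS => y /= /existsNP[i /existsNP[eps /not_implyP[eps0 /contrapT ky]]].
exists (Num.truncn eps^-1) => //.
have [M HM] : exists M : nat, forall j, `|y 0 j| <= M%:R.
  exists (Num.truncn (\sum_j `|y 0 j|)).+1 => j.
  apply: ltW; apply: (le_lt_trans _ (truncnS_gt _)).
  by rewrite (bigD1 j)//= lerDl sumr_ge0.
exists M => //; rewrite -bigcup_seq.
exists i; [by rewrite /= mem_index_enum|split]; last by move=> j _; exact: HM.
move=> k; apply: le_trans (ky k); rewrite ler_pM2r ?invr_gt0//.
apply: ltW; rewrite invf_plt ?posrE//; exact: truncnS_gt.
Qed.

End borel_rV.

(** * Convexity of the semi-dual functional *)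

Section any_integral.
Context {disp : measure_display} {T : measurableType disp} {R : realType}.
Variable mu : {measure set T -> \bar R}.

(** Monotonicity of the lower integrals of the positive and negative parts. *)
Lemma le_integral_any (D : set T) (f g : T -> \bar R) :
  (forall x, D x -> f x <= g x)%E ->
  (\int[mu]_(x in D) f x <= \int[mu]_(x in D) g x)%E.
Proof.
move=> fg; rewrite (integralE _ _ f) (integralE _ _ g); apply: leeB.
  apply: le_lower_integral => x Dx; first exact: funepos_ge0.
  by rewrite !funeposE; apply: le_max2 => //; exact: fg.
apply: le_lower_integral => x Dx; first exact: funeneg_ge0.
by rewrite !funenegE; apply: le_max2 => //; rewrite leeN2; exact: fg.
Qed.

Lemma integral_bounded_below (D : set T) (f : T -> \bar R) (M : R) :
  measurable D -> (mu D < +oo)%E -> measurable_fun D f ->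
  (forall x, D x -> (- M)%:E <= f x)%E ->
  (-oo < \int[mu]_(x in D) f x)%E /\
  ((\int[mu]_(x in D) f x < +oo)%E -> mu.-integrable D f).
Proof.
move=> mD muD mf fM.
have negfin : (\int[mu]_(x in D) f^\- x < +oo)%E.
  apply: (@le_lt_trans _ _ (\int[mu]_(x in D) (Num.max M 0)%:E)%E).
    apply: le_lower_integral => x Dx; first exact: funeneg_ge0.
    rewrite funenegE EFin_max; apply: le_max2 => //.
    by rewrite leeNl -EFinN; exact: fM.
  by rewrite integral_cst// lte_mul_pinfty// lee_fin le_max lexx orbT.
have negfin' : (\int[mu]_(x in D) f^\- x)%E \is a fin_num.
  by rewrite ge0_fin_numE// integral_ge0// => x _; exact: funeneg_ge0.
have pos0 : (0 <= \int[mu]_(x in D) f^\+ x)%E by apply: integral_ge0 => x _; exact: funepos_ge0.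
have N1 : (- \int[mu]_(x in D) f^\- x)%E \is a fin_num by rewrite fin_numN.
rewrite integralE; split.
  rewrite ltNye; apply/eqP => E; move: pos0.
  by rewrite -(subeK (\int[mu]_(x in D) f^\+ x)%E negfin') E addNye.
move=> fin.
have posfin : (\int[mu]_(x in D) f^\+ x < +oo)%E.
  rewrite ltey; apply/eqP => E; move: fin; rewrite E addye ?ltxx//.
  by move: N1; rewrite fin_numE => /andP[].
apply/integrableP; split => //.
have -> : (\int[mu]_(x in D) `|f x| = \int[mu]_(x in D) (f^\+ x + f^\- x))%E.
  by apply: eq_integral => x _; rewrite -[`|f x|%E]/((abse \o f) x) fune_abse.
rewrite ge0_integralD//.
- exact: lte_add_pinfty.
- exact: measurable_funepos.
- exact: measurable_funeneg.
Qed.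

End any_integral.

Section semidual_convexity.
Context {R : realType} {d : nat}.
Local Notation T := (borelRV R d).

(** The integrands may take the value +oo but are bounded below because [s <=
    phi^* s].  So either an integral on the right is +oo or both integrands
    are integrable. *)
Lemma integral_legendre_convex (m : {finite_measure set T -> \bar R}) (phi : R -> \bar R)
    (D : set 'rV[R]_d) (a b c : 'rV[R]_d -> R) (M t : R) :
  entropy_function phi -> compact D -> 0 <= t <= 1 ->
  measurable_fun (D : set T) (a : T -> R) -> measurable_fun (D : set T) (b : T -> R) ->
  (forall x, D x -> - M <= a x) -> (forall x, D x -> - M <= b x) ->
  (forall x, D x -> c x <= t * a x + (1 - t) * b x) ->
  (\int[m]_(x in D) legendre phi (c x) <=
    t%:E * \int[m]_(x in D) legendre phi (a x)
    + (1 - t)%R%:E * \int[m]_(x in D) legendre phi (b x))%E /\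
  (-oo < \int[m]_(x in D) legendre phi (a x))%E.
Proof.
move=> phiE cD t01 ma mb aM bM cab.
have mD : measurable (D : set T) by exact: compact_measurable_rV.
have mDfin : (m D < +oo)%E by rewrite ltey_eq fin_num_measure.
have mleg (u : T -> R) : measurable_fun (D : set T) u ->
    measurable_fun (D : set T) (fun x => legendre phi (u x)).
  by move=> mu; apply: measurableT_comp => //; exact: legendre_measurable.
have legM (u : 'rV[R]_d -> R) : (forall x, D x -> - M <= u x) ->
    forall x, D x -> ((- M)%:E <= legendre phi (u x))%E.
  by move=> uM x Dx; apply: le_trans (legendre_ge phi phiE (u x)); rewrite lee_fin; exact: uM.
have [a1 a2] := integral_bounded_below m _ _ M mD mDfin (mleg _ ma) (legM _ aM).
have [b1 b2] := integral_bounded_below m _ _ M mD mDfin (mleg _ mb) (legM _ bM).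
split => //.
have step : (\int[m]_(x in D) legendre phi (c x) <= \int[m]_(x in D)
    (t%:E * legendre phi (a x) + (1 - t)%R%:E * legendre phi (b x)))%E.
  apply: le_integral_any => x Dx.
  apply: le_trans (legendre_convex phi phiE _ _ _ t01).
  by apply: legendre_mono; exact: cab.
move: t01 => /andP[t0 t1].
have NyM (r : R) (x : \bar R) : 0 <= r -> (-oo < x)%E -> (r%:E * x != -oo)%E.
  move=> r0; case: x => [x| |]// _.
  move: r0; rewrite le_eqVlt => /orP[/eqP <-|r0]; first by rewrite mul0e.
  by rewrite gt0_muley// lte_fin.
have s0 : 0 <= 1 - t by rewrite subr_ge0.
have [ta|ta] := eqVneq t 0.
  rewrite ta mul0e add0e subr0 mul1e.
  apply: le_integral_any => x Dx; apply: legendre_mono.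
  by have := cab _ Dx; rewrite ta mul0r add0r subr0 mul1r.
have [tb|tb] := eqVneq t 1.
  rewrite tb subrr mul0e adde0 mul1e.
  apply: le_integral_any => x Dx; apply: legendre_mono.
  by have := cab _ Dx; rewrite tb subrr mul0r addr0 mul1r.
have tpos : 0 < t by rewrite lt_neqAle eq_sym ta.
have spos : 0 < 1 - t by rewrite subr_gt0 lt_neqAle tb.
have [Ea|Ea] := eqVneq (\int[m]_(x in D) legendre phi (a x))%E +oo%E.
  by rewrite Ea gt0_muley ?lte_fin// addye ?leey// NyM.
have [Eb|Eb] := eqVneq (\int[m]_(x in D) legendre phi (b x))%E +oo%E.
  by rewrite Eb gt0_muley ?lte_fin// addey ?leey// NyM.
have ia := a2 (_ : _ < +oo)%E; rewrite ltey Ea in ia; have {}ia := ia isT.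
have ib := b2 (_ : _ < +oo)%E; rewrite ltey Eb in ib; have {}ib := ib isT.
apply: le_trans step _; rewrite integralD//; [|exact: integrableZl|exact: integrableZl].
by rewrite !integralZl.
Qed.

Lemma compact_bound (X : set 'rV[R]_d) (f : 'rV[R]_d -> R) : compact X ->
  {within X, continuous f} -> exists M : R, forall x, X x -> `|f x| <= M.
Proof.
move=> cX cf.
have [X0|X0] := pselect (X !=set0); last by exists 0 => x Xx; case: X0; exists x.
have [M _ HM] := compact_EVT_max X0 cX cf.
have [m _ Hm] := compact_EVT_min X0 cX cf.
exists (`|f M| + `|f m|) => x /mem_set Xx.
have := HM _ Xx; have := Hm _ Xx; have := ler_norm (f M); have := ler_norm (- f m).
have := normr_ge0 (f M); have := normr_ge0 (f m).
by rewrite normrN ler_norml => *; lra.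
Qed.

Lemma fenchel0 (z : 'rV[R]_d -> R) y : fenchel set0 z y = 0.
Proof. by rewrite /fenchel image_set0 sup0. Qed.

Lemma fenchel_continuousT (X : set 'rV[R]_d) z : compact X -> {within X, continuous z} ->
  continuous (fenchel X z).
Proof.
move=> cX cz; have [X0|] := pselect (X !=set0); last first.
  move/set0P/negP; rewrite negbK => /eqP ->.
  rewrite (_ : fenchel set0 z = cst 0); first by move=> ?; exact: cst_continuous.
  by apply/funext => y; rewrite fenchel0.
have [L _ HL] := compact_coord_bound X cX.
exact: (fenchel_continuous X cX X0 _ _ cz HL).
Qed.

Lemma within_potential (X : set 'rV[R]_d) z : {within X, continuous z} ->
  {within X, continuous (fun x => z x - q x)}.
Proof.
move=> cz; apply: within_continuousB => //; exact: continuous_subspaceT continuous_q.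
Qed.

Lemma within_conjugate (X Y : set 'rV[R]_d) z : compact X -> {within X, continuous z} ->
  {within Y, continuous (fun y => fenchel X z y - q y)}.
Proof.
move=> cX cz; apply: within_potential; apply: continuous_subspaceT.
exact: fenchel_continuousT.
Qed.

Lemma semidual_convex (X Y : set 'rV[R]_d) (mu nu : {finite_measure set T -> \bar R})
    (phi : R -> \bar R) (z1 z2 : 'rV[R]_d -> R) (t : R) :
  compact X -> compact Y -> entropy_function phi ->
  {within X, continuous z1} -> {within X, continuous z2} -> 0 <= t <= 1 ->
  (semidual X Y mu nu phi (fun x => (t * z1 x + (1 - t) * z2 x)%R)
    <= t%:E * semidual X Y mu nu phi z1 + (1 - t)%R%:E * semidual X Y mu nu phi z2)%E.
Proof.
move=> cX cY phiE c1 c2 t01; have /andP[t0 t1] := t01.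
have bound (D : set 'rV[R]_d) (f : 'rV[R]_d -> R) : compact D -> {within D, continuous f} ->
    exists M, forall x, D x -> - M <= f x.
  move=> cD cf; have [M HM] := compact_bound D f cD cf; exists M => x /HM.
  by rewrite ler_norml => /andP[].
have mono (D : set 'rV[R]_d) (f : 'rV[R]_d -> R) (M N : R) : (forall x, D x -> - M <= f x) -> M <= N ->
    forall x, D x -> - N <= f x.
  by move=> H MN x /H; apply: le_trans; rewrite lerN2.
have key (m : {finite_measure set T -> \bar R}) (D : set 'rV[R]_d) (a b c : 'rV[R]_d -> R) : compact D ->
    {within D, continuous a} -> {within D, continuous b} ->
    (forall x, D x -> c x <= t * a x + (1 - t) * b x) ->
    [/\ (\int[m]_(x in D) legendre phi (c x) <=
      t%:E * \int[m]_(x in D) legendre phi (a x)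
      + (1 - t)%R%:E * \int[m]_(x in D) legendre phi (b x))%E,
      (-oo < \int[m]_(x in D) legendre phi (a x))%E &
      (-oo < \int[m]_(x in D) legendre phi (b x))%E].
  move=> cD ca cb cab.
  have [M1 H1] := bound D a cD ca; have [M2 H2] := bound D b cD cb.
  have H1' := mono _ _ _ (Num.max M1 M2) H1 _.
  have H2' := mono _ _ _ (Num.max M1 M2) H2 _.
  rewrite le_max lexx /= in H1'; rewrite le_max lexx orbT /= in H2'.
  have ma := within_continuous_measurable _ _ cD ca.
  have mb := within_continuous_measurable _ _ cD cb.
  have [k1 k2] := integral_legendre_convex m phi D a b c _ t phiE cD t01 ma mb (H1' isT) (H2' isT) cab.
  have s01 : 0 <= (1 - t) <= 1 by rewrite subr_ge0 t1 lerBlDr lerDl.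
  have [_ k3] := integral_legendre_convex m phi D b a (fun x => (1 - t) * b x + (1 - (1 - t)) * a x) _ (1 - t) phiE cD s01 mb ma (H2' isT) (H1' isT) (fun _ _ => lexx _).
  by split.
have [x1 x2 x3] := key mu X (fun x => z1 x - q x) (fun x => z2 x - q x)
  (fun x => t * z1 x + (1 - t) * z2 x - q x) cX (within_potential _ _ c1) (within_potential _ _ c2)
  (fun x _ => ltac:(rewrite le_eqVlt; apply/orP; left; apply/eqP; ring)).
have cconj y : Y y -> fenchel X (fun x => t * z1 x + (1 - t) * z2 x) y - q y
    <= t * (fenchel X z1 y - q y) + (1 - t) * (fenchel X z2 y - q y).
  move=> _; have [X0|] := pselect (X !=set0); last first.
    move/set0P/negP; rewrite negbK => /eqP ->; rewrite !fenchel0.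
    by rewrite le_eqVlt; apply/orP; left; apply/eqP; ring.
  by have := fenchel_conv X cX X0 _ _ y t c1 c2 t01; lra.
have [y1 y2 y3] := key nu Y _ _ _ cY (within_conjugate X Y _ cX c1) (within_conjugate X Y _ cX c2) cconj.
have def (a b : \bar R) : (-oo < a -> -oo < b -> a +? b)%E.
  by move=> a0 b0; rewrite /adde_def (gt_eqF a0) (gt_eqF b0) andbF.
have E1 := muleDr (isT : t%:E \is a fin_num) (def _ _ x2 y2).
have E2 := muleDr (isT : (1 - t)%:E \is a fin_num) (def _ _ x3 y3).
rewrite /semidual E1 E2 [leRHS]addeACA; exact: (leeD x1 y1).
Qed.

End semidual_convexity.

(** * Pointwise bounds for the convexity defects *)

Section pointwise.
Context {R : realType} (f : R -> R).
Hypotheses (df : forall s, derivable f s 1) (mf : forall s s', s <= s' -> f s <= f s').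

Definition strongly_on (K : set R) (alpha : R) : Prop :=
  forall s s' t, K s -> K s' -> 0 <= t <= 1 ->
    f (t * s + (1 - t) * s')
      <= t * f s + (1 - t) * f s' - alpha / 2 * (t * (1 - t)) * (s - s') ^+ 2.

(** The Bregman divergence of [f] between [a] and [b], with the tangent term
    at [a] replaced by a difference quotient with step [1 / k]. *)
Definition defect (k a b c : R) : R := f b - f a - k * (f c - f a).

Lemma eventually_inv (e : R) : 0 < e ->
  exists N, forall n, (N <= n)%N -> n.+1%:R^-1 <= e.
Proof.
move=> e0; exists (Num.truncn e^-1) => n Nn.
rewrite invf_ple ?posrE// (le_trans (ltW (truncnS_gt _)))//.
by rewrite ler_nat ltnS.
Qed.

(** Strong convexity on the segment from [a] to [b], divided by the weight [1
    / (n + 1)] of [b]; the gain keeps the factor that is the weight of [a]. *)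
Lemma defect_ge0 (K : set R) alpha n a b c : strongly_on K alpha -> K a -> K b ->
  0 <= alpha ->
  c <= n.+1%:R^-1 * b + (1 - n.+1%:R^-1) * a ->
  alpha / 2 * (1 - n.+1%:R^-1) * (b - a) ^+ 2 <= defect n.+1%:R a b c.
Proof.
move=> sK Ka Kb a0 cab; rewrite /defect.
have n0 : 0 < n.+1%:R :> R by rewrite ltr0n.
set t := n.+1%:R^-1 in cab *.
have t0 : 0 < t by rewrite invr_gt0.
have t1 : t <= 1 by rewrite invf_le1// ler1n.
have nt : n.+1%:R * t = 1 by rewrite divff// gt_eqF.
have t01 : 0 <= t <= 1 by rewrite ltW.
have h := le_trans (mf _ _ cab) (sK _ _ _ Kb Ka t01).
have h2 : n.+1%:R * (f c - f a) <= n.+1%:R * (t * (f b - f a - alpha / 2 * (1 - t) * (b - a) ^+ 2)).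
  by rewrite ler_pM2l//; lra.
by move: h2; rewrite mulrA nt mul1r; lra.
Qed.

Context {d : nat} (X : set 'rV[R]_d) (z z0 : 'rV[R]_d -> R).
Hypotheses (cX : compact X) (cz : {within X, continuous z})
  (cz0 : {within X, continuous z0}).

(** With [p] the derivative at [a] and [r = eps - h x0], the envelope bound
    and the expansion of [f] at [a] give [n (f c - f a) <= p r + eps |r|], and
    [f b - f a >= p (b - a) + alpha / 2 (b - a)^2].  The difference [b - a -
    r] is the Fenchel-Young gap of [z] at [x0], up to [eps]. *)
Lemma conjugate_defect (K : set R) alpha lambda y e : X !=set0 ->
  strongly_convex_on X lambda z ->
  smooth_point (fenchel X z) y -> smooth_point (fenchel X z0) y ->
  strongly_on K alpha -> 0 <= alpha ->
  K (fenchel X z y - q y) -> K (fenchel X z0 y - q y) -> 0 < e ->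
  exists N, forall n, (N <= n)%N ->
    lambda / 2 * (derive1 f (fenchel X z0 y - q y)
        * sqnorm (grad (fun u => fenchel X z0 u - fenchel X z u) y))
      + alpha / 2 * (fenchel X z0 y - fenchel X z y) ^+ 2 - e
    <= defect n.+1%:R (fenchel X z0 y - q y) (fenchel X z y - q y)
         (fenchel X (fun x => n.+1%:R^-1 * z x + (1 - n.+1%:R^-1) * z0 x) y - q y).
Proof.
move=> X0 sz smz smz0 sK alpha0 Kb Ka e0.
have [x0 Xx0 [E0 max0]] := fenchel_max X cX X0 z0 y cz0.
have [x1 Xx1 [E1 max1]] := fenchel_max X cX X0 z y cz.
rewrite (grad_fenchelB X _ _ _ _ y cX Xx0 Xx1 cz0 cz E0 E1 smz0 smz).
have gap := strongly_convex_gap X lambda z x0 x1 y cX cz sz Xx0 Xx1 E1.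
have uniq x' : X x' -> dot x' y - z0 x' = fenchel X z0 y -> x' = x0.
  move=> Xx' /esym E'; apply: (smooth_subgradient_unique _ _ _ y (fenchel_convex X cX X0 _ cz0) smz0).
    exact: (maximizer_subgradient X z0 x' y cX Xx' cz0 E').
  exact: (maximizer_subgradient X z0 x0 y cX Xx0 cz0 E0).
set a := fenchel X z0 y - q y in Ka *; set b := fenchel X z y - q y in Kb *.
pose p := derive1 f a.
have p0 : 0 <= p by exact: derivable_derive1_ge0.
pose h x := z x - z0 x.
have ch : {within X, continuous h} by exact: within_continuousB.
(* the total error is p * eps + eps * |r|, where |r| <= |h x0| + 1 *)
pose eps := Num.min 1 (e / (p + `|h x0| + 1)).
have den0 : 0 < p + `|h x0| + 1 by have := normr_ge0 (h x0); lra.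
have eps0 : 0 < eps by rewrite lt_min ltr01 divr_gt0.
have eps1 : eps <= 1 by rewrite ge_min lexx.
have epse : eps * (p + `|h x0| + 1) <= e by rewrite -ler_pdivlMr// ge_min lexx orbT.
have [t0 t0pos dan] := danskin X z0 h x0 y eps cX Xx0 cz0 ch uniq eps0.
have [del del0 expd] := derivable_expansion f df a eps eps0.
pose r := - (h x0 - eps).
have rle : `|r| <= `|h x0| + 1.
  by rewrite normrN; apply: le_trans (ler_normB _ _) _; rewrite lerD2l gtr0_norm.
have h1pos : 0 < `|h x0| + 1 by have := normr_ge0 (h x0); lra.
have m0 : 0 < Num.min t0 (del / (`|h x0| + 1) / 2) by rewrite lt_min t0pos !divr_gt0.
have [N HN] := eventually_inv _ m0.
exists N => n /HN; rewrite le_min => /andP[tt0 tdel].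
have n0 : 0 < n.+1%:R :> R by rewrite ltr0n.
set t := n.+1%:R^-1 in tt0 tdel *.
have tpos : 0 < t by rewrite invr_gt0.
have nt : n.+1%:R * t = 1 by rewrite divff// gt_eqF.
have -> : (fun x => t * z x + (1 - t) * z0 x) = (fun x => z0 x + t * h x).
  by apply/funext => x; rewrite /h; ring.
set c := fenchel X _ y - q y.
have cle : c <= a + t * r.
  by have := dan t; rewrite tpos tt0 => /(_ isT); rewrite /c /a /r; lra.
have trdel : `|t * r| < del.
  rewrite normrM (gtr0_norm tpos).
  apply: (@le_lt_trans _ _ (t * (`|h x0| + 1))); first by rewrite ler_pM2l.
  rewrite -ltr_pdivlMr//; apply: le_lt_trans tdel _.
  by rewrite gtr_pMr ?divr_gt0// invf_lt1// ltr1n.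
have := expd _ trdel; rewrite ler_norml -/p => /andP[_ ex].
have fc : f c - f a <= t * (r * p + eps * `|r|).
  have := mf _ _ cle; rewrite normrM (gtr0_norm tpos) in ex.
  by lra.
have nfc : n.+1%:R * (f c - f a) <= r * p + eps * `|r|.
  by apply: le_trans (_ : n.+1%:R * (t * (r * p + eps * `|r|)) <= _); [rewrite ler_pM2l|rewrite mulrA nt mul1r].
have tang := strong_tangent_bound f df K alpha a b sK alpha0 Ka Kb.
have gap' : p * (lambda / 2 * sqnorm (x0 - x1)) <= p * (b - a - r + eps).
  apply: ler_wpM2l => //; apply: le_trans gap _.
  by rewrite /b /a /r E0 /h; lra.
have er : eps * `|r| <= eps * (`|h x0| + 1) by rewrite ler_pM2l.
have -> : (fenchel X z0 y - fenchel X z y) ^+ 2 = (b - a) ^+ 2 by rewrite /a /b; ring.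
rewrite /defect -/p; rewrite -/p in tang.
have -> : lambda / 2 * (p * sqnorm (x0 - x1)) = p * (lambda / 2 * sqnorm (x0 - x1)) by ring.
move: nfc gap' tang er epse; clear; move: (n.+1%:R * _) => w; lra.
Qed.

End pointwise.

(** * The stability estimate *)

Section convex_on_lemmas.
Context {R : realType} {d : nat} (X : set 'rV[R]_d).
Implicit Types z : 'rV[R]_d -> R.

Lemma convex_onI z :
  (forall x y t, X x -> X y -> 0 <= t <= 1 -> X (t *: x + (1 - t) *: y)) ->
  (forall x y t, X x -> X y -> 0 <= t <= 1 ->
     z (t *: x + (1 - t) *: y) <= t * z x + (1 - t) * z y) ->
  convex_on X z.
Proof.
move=> H1 H2; split.
  move=> x y t /set_mem Xx /set_mem Xy; apply/mem_set; apply: H1 => //.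
  by apply/andP; split; [exact: ge0|exact: le1].
move=> t x y /set_mem Xx /set_mem Xy; apply: H2 => //.
by apply/andP; split; [exact: ge0|exact: le1].
Qed.

Lemma convex_on_mix z z' t : convex_on X z -> convex_on X z' -> 0 <= t <= 1 ->
  convex_on X (fun x => t * z x + (1 - t) * z' x).
Proof.
move=> /convex_onP[Xc zc] /convex_onP[_ zc'] /andP[t0 t1]; apply: convex_onI => // x y s Xx Xy s01.
have h1 := ler_wpM2l t0 (zc _ _ _ Xx Xy s01).
have s0 : 0 <= 1 - t by rewrite subr_ge0.
have h2 := ler_wpM2l s0 (zc' _ _ _ Xx Xy s01).
lra.
Qed.

Lemma strongly_convex_convex lambda z : 0 <= lambda ->
  strongly_convex_on X lambda z -> convex_on X z.
Proof.
move=> l0 /convex_onP[Xc zc]; apply: convex_onI => // x y s Xx Xy s01.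
have := zc _ _ _ Xx Xy s01; rewrite q_conv => h.
have /andP[s0 s1] := s01.
have : 0 <= lambda * (s * (1 - s) / 2 * sqnorm (x - y)).
  by rewrite !mulr_ge0 ?sqnorm_ge0 ?subr_ge0.
lra.
Qed.

Lemma convex_strongly_convex0 z : convex_on X z -> strongly_convex_on X 0 z.
Proof.
move=> /convex_onP[Xc zc]; apply: convex_onI => // x y s Xx Xy s01.
by rewrite !mul0r !subr0; exact: zc.
Qed.

Lemma Cb_mix z z' t : compact X -> Cb X z -> Cb X z' ->
  Cb X (fun x => t * z x + (1 - t) * z' x).
Proof.
move=> cX [cz _] [cz' _].
have c : {within X, continuous (fun x => t * z x + (1 - t) * z' x)}.
  by apply: within_continuousD; exact: within_continuousZ.
split => //; exact: compact_bound.
Qed.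

End convex_on_lemmas.

Section integrals_of_continuous.
Context {R : realType} {d : nat}.
Local Notation T := (borelRV R d).
Variables (m : {finite_measure set T -> \bar R}) (D : set 'rV[R]_d).
Hypothesis cD : compact D.
Implicit Types f : 'rV[R]_d -> R.

Lemma within_continuous_integrable f : {within D, continuous f} ->
  m.-integrable (D : set T) (EFin \o (f : T -> R)).
Proof.
move=> cf; apply: measurable_bounded_integrable.
- exact: compact_measurable_rV.
- by rewrite ltey_eq fin_num_measure//; exact: compact_measurable_rV.
- exact: within_continuous_measurable.
have [M HM] := compact_bound D f cD cf.
by exists M; split; [exact: num_real|move=> r Mr x Dx; apply: le_trans (HM _ Dx) (ltW Mr)].
Qed.

Lemma within_continuous_comp (g : R -> R) f : continuous g -> {within D, continuous f} ->
  {within D, continuous (fun x => g (f x))}.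
Proof.
by move=> cg cf x; apply: (@continuous_comp (subspace D) R R f g x (cf x)); exact: cg.
Qed.

Lemma integral_defect (a b c : 'rV[R]_d -> R) (k : R) :
  {within D, continuous a} -> {within D, continuous b} -> {within D, continuous c} ->
  (\int[m]_(x in D) (b x - a x - k * (c x - a x))%:E =
   (\int[m]_(x in D) b x - \int[m]_(x in D) a x
     - k * (\int[m]_(x in D) c x - \int[m]_(x in D) a x))%:E)%E.
Proof.
move=> ca cb cc.
have mD : measurable (D : set T) by exact: compact_measurable_rV.
have cd := within_continuousB _ _ _ cc ca.
have cf := within_continuousB _ _ _ (within_continuousB _ _ _ cb ca) (within_continuousZ _ k _ cd).
rewrite -[LHS]fineK; last exact: (integrable_fin_num mD (within_continuous_integrable _ cf)).
congr EFin; rewrite -/(Rintegral _ _ _).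
rewrite -(RintegralB mD (within_continuous_integrable _ cc) (within_continuous_integrable _ ca)).
rewrite -(RintegralZl k mD (within_continuous_integrable _ cd)).
rewrite -(RintegralB mD (within_continuous_integrable _ cb) (within_continuous_integrable _ ca)).
rewrite -RintegralB//.
- exact: (within_continuous_integrable _ (within_continuousB _ _ _ cb ca)).
- exact: (within_continuous_integrable _ (within_continuousZ _ k _ cd)).
Qed.

End integrals_of_continuous.

Lemma le_limn_einf_eps {R : realType} (u : nat -> R) (c : R) :
  (forall e, 0 < e -> exists N, forall n, (N <= n)%N -> c - e <= u n) ->
  (c%:E <= limn_einf (fun n => (u n)%:E))%E.
Proof.
move=> H; apply/lee_subgt0Pr => e /H[N HN].
apply: (@le_limn_einf _ _ _ N) => n /HN.
by rewrite -EFinB lee_fin.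
Qed.


Section stability.
Context {R : realType} {d : nat} (X Y : set 'rV[R]_d).
Variables (mu nu : {finite_measure set (borelRV R d) -> \bar R}) (phi : R -> \bar R).
Hypotheses (cX : compact X) (cY : compact Y) (phiE : entropy_function phi)
  (phifin : forall s, legendre phi s \is a fin_num).
Let phis s := fine (legendre phi s).
Hypotheses (dphis : forall s, derivable phis s 1).
Implicit Types z : 'rV[R]_d -> R.

Lemma phis_within (D : set 'rV[R]_d) z : {within D, continuous z} ->
  {within D, continuous (fun x => phis (z x))}.
Proof. by move=> cz; apply: within_continuous_comp => //; exact: derivable_continuous. Qed.

Lemma phis_strongly0 : strongly_on phis setT 0.
Proof.
move=> s s' t _ _ t01; apply: le_trans (phis_convex phi phiE phifin _ _ _ t01) _.
by rewrite !mul0r subr0.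
Qed.

Definition semidual_fine z : R :=
  \int[mu]_(x in X) phis (z x - q x) + \int[nu]_(y in Y) phis (fenchel X z y - q y).

Lemma semidualE z : {within X, continuous z} ->
  semidual X Y mu nu phi z = (semidual_fine z)%:E.
Proof.
move=> cz; rewrite /semidual /semidual_fine EFinD.
have key (m : {finite_measure set (borelRV R d) -> \bar R}) (D : set 'rV[R]_d)
    (w : 'rV[R]_d -> R) : compact D -> {within D, continuous w} ->
    (\int[m]_(x in D) legendre phi (w x))%E = (\int[m]_(x in D) phis (w x))%:E.
  move=> cD cw; rewrite /Rintegral fineK.
    by apply: eq_integral => x _; rewrite /phis fineK.
  apply: (integrable_fin_num (compact_measurable_rV _ cD)).
  by apply: (within_continuous_integrable m _ cD); exact: phis_within.
rewrite (key mu X _ cX (within_potential _ _ cz)).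
by rewrite (key nu Y _ cY (within_conjugate X Y _ cX cz)).
Qed.

Variables (z z0 : 'rV[R]_d -> R).
Hypotheses (Cz : Cb X z) (vz : convex_on X z) (oz0 : optimal_potential X Y mu nu phi z0).

Let cz : {within X, continuous z}. Proof. by case: Cz. Qed.
Let cz0 : {within X, continuous z0}. Proof. by case: oz0 => -[]. Qed.

Let zn (n : nat) x : R := n.+1%:R^-1 * z x + (1 - n.+1%:R^-1) * z0 x.

Let czn n : {within X, continuous (zn n)}.
Proof. by apply: within_continuousD; exact: within_continuousZ. Qed.

Let t01 n : 0 <= (n.+1%:R^-1 : R) <= 1.
Proof. by rewrite invr_ge0 ler0n invf_le1 ?ltr0n// ler1n. Qed.

Let defX n x := defect phis n.+1%:R (z0 x - q x) (z x - q x) (zn n x - q x).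
Let defY n y := defect phis n.+1%:R (fenchel X z0 y - q y) (fenchel X z y - q y)
  (fenchel X (zn n) y - q y).

Let optimal_zn n : semidual_fine z0 <= semidual_fine (zn n).
Proof.
case: oz0 => C0 v0 opt.
have := opt (zn n) (Cb_mix X z z0 _ cX Cz C0) (convex_on_mix X z z0 _ vz v0 (t01 n)).
by rewrite (semidualE _ cz0) (semidualE _ (czn n)) lee_fin.
Qed.

Lemma sum_defects_le n :
  (\int[mu]_(x in X) (defX n x)%:E + \int[nu]_(y in Y) (defY n y)%:E
    <= semidual X Y mu nu phi z - semidual X Y mu nu phi z0)%E.
Proof.
have cw w : {within X, continuous w} -> {within X, continuous (fun x => phis (w x - q x))}.
  by move=> ?; apply: phis_within; exact: within_potential.
have cw' w : {within X, continuous w} ->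
    {within Y, continuous (fun y => phis (fenchel X w y - q y))}.
  by move=> ?; apply: phis_within; exact: within_conjugate.
have E1 := integral_defect mu X cX _ _ _ n.+1%:R (cw _ cz0) (cw _ cz) (cw _ (czn n)).
have E2 := integral_defect nu Y cY _ _ _ n.+1%:R (cw' _ cz0) (cw' _ cz) (cw' _ (czn n)).
rewrite /defX /defY /defect E1 E2 !semidualE// -EFinB -EFinD lee_fin.
have : 0 <= n.+1%:R * (semidual_fine (zn n) - semidual_fine z0).
  by rewrite mulr_ge0// subr_ge0.
rewrite /semidual_fine.
move: (Rintegral mu X (fun x => phis (z x - q x))) (Rintegral mu X (fun x => phis (z0 x - q x)))
  (Rintegral mu X (fun x => phis (zn n x - q x)))
  (Rintegral nu Y (fun y => phis (fenchel X z y - q y)))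
  (Rintegral nu Y (fun y => phis (fenchel X z0 y - q y)))
  (Rintegral nu Y (fun y => phis (fenchel X (zn n) y - q y))) n.+1%:R => a b c a' b' c' k.
lra.
Qed.

Let mixX n x : zn n x - q x <= n.+1%:R^-1 * (z x - q x) + (1 - n.+1%:R^-1) * (z0 x - q x).
Proof. by rewrite le_eqVlt; apply/orP; left; apply/eqP; rewrite /zn; ring. Qed.

Let mixY n y : X !=set0 -> fenchel X (zn n) y - q y
  <= n.+1%:R^-1 * (fenchel X z y - q y) + (1 - n.+1%:R^-1) * (fenchel X z0 y - q y).
Proof.
move=> X0.
have H : fenchel X (zn n) y <= n.+1%:R^-1 * fenchel X z y + (1 - n.+1%:R^-1) * fenchel X z0 y.
  exact: (fenchel_conv X cX X0 z z0 y _ cz cz0 (t01 n)).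
move: H; move: (fenchel X (zn n) y) (fenchel X z y) (fenchel X z0 y) (n.+1%:R^-1) => u v w t H.
lra.
Qed.

Let defX_ge0 n x : 0 <= defX n x.
Proof.
apply: le_trans (defect_ge0 phis (phis_mono phi phifin) setT 0 n _ _ _ phis_strongly0 I I (lexx _) (mixX n x)).
by rewrite !mul0r.
Qed.

Let defY_ge0 n y : X !=set0 -> 0 <= defY n y.
Proof.
move=> X0.
apply: le_trans (defect_ge0 phis (phis_mono phi phifin) setT 0 n _ _ _ phis_strongly0 I I (lexx _) (mixY n y X0)).
by rewrite !mul0r.
Qed.

Let measX n : measurable_fun (X : set (borelRV R d)) (fun x => (defX n x)%:E).
Proof.
apply/measurable_EFinP; apply: within_continuous_measurable => //.
have c w : {within X, continuous w} -> {within X, continuous (fun x => phis (w x - q x))}.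
  by move=> cw; apply: phis_within; exact: within_potential.
apply: within_continuousB; first by apply: within_continuousB; exact: c.
by apply: within_continuousZ; apply: within_continuousB; exact: c.
Qed.

Let measY n : measurable_fun (Y : set (borelRV R d)) (fun y => (defY n y)%:E).
Proof.
apply/measurable_EFinP; apply: within_continuous_measurable => //.
have c w : {within X, continuous w} ->
    {within Y, continuous (fun y => phis (fenchel X w y - q y))}.
  by move=> cw; apply: phis_within; exact: within_conjugate.
apply: within_continuousB; first by apply: within_continuousB; exact: c.
by apply: within_continuousZ; apply: within_continuousB; exact: c.
Qed.

Let fatou_bound : X !=set0 ->
  (\int[mu]_(x in X) limn_einf (fun n => (defX n x)%:E)
   + \int[nu]_(y in Y) limn_einf (fun n => (defY n y)%:E)
   <= semidual X Y mu nu phi z - semidual X Y mu nu phi z0)%E.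
Proof.
move=> X0.
have fX := fatou mu (compact_measurable_rV _ cX) measX (fun n x _ => defX_ge0 n x : (0 <= (defX n x)%:E)%E).
have fY := fatou nu (compact_measurable_rV _ cY) measY (fun n y _ => defY_ge0 n y X0 : (0 <= (defY n y)%:E)%E).
apply: le_trans (leeD fX fY) _; apply: limn_einfD_le.
- by move=> n; apply: integral_ge0 => x _; exact: defX_ge0.
- by move=> n; apply: integral_ge0 => y _; exact: defY_ge0.
- exact: sum_defects_le.
Qed.

(** Fatou's lemma for the two defects, whose pointwise bounds hold almost
    everywhere.  The set [K] has to contain the arguments of phi^* up to null
    sets only, so that it can be chosen before [z0].  The case [lambda = 0]
    compares optimal potentials. *)
Lemma semidual_gap (K : set R) (alpha lambda : R) :
  nu `<< @lebesgue_rV R d ->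
  0 <= lambda -> strongly_convex_on X lambda z ->
  0 <= alpha -> strongly_on phis K alpha ->
  {ae mu, forall x, X x -> K (z x - q x) /\ K (z0 x - q x)} ->
  {ae nu, forall y, Y y -> K (fenchel X z y - q y) /\ K (fenchel X z0 y - q y)} ->
  ((lambda / 2)%:E *
      (\int[nu]_(y in Y) (derive1 phis (fenchel X z0 y - q y)
         * sqnorm (grad (fun u => fenchel X z0 u - fenchel X z u) y))%:E)
    + (alpha / 2)%:E * (\int[nu]_(y in Y) ((fenchel X z0 y - fenchel X z y) ^+ 2)%:E)
    + (alpha / 2)%:E * (\int[mu]_(x in X) ((z0 x - z x) ^+ 2)%:E)
    <= semidual X Y mu nu phi z - semidual X Y mu nu phi z0)%E.
Proof.
move=> nuL l0 sz a0 sK aeX aeY.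
have l20 : 0 <= lambda / 2 by rewrite divr_ge0.
have a20 : 0 <= alpha / 2 by rewrite divr_ge0.
have mono := phis_mono phi phifin.
have [X0|] := pselect (X !=set0); last first.
  move/set0P/negP; rewrite negbK => /eqP X0.
  (* over the empty set all conjugates are 0, the default value of sup *)
  have E1 y : grad (fun u => fenchel X z0 u - fenchel X z u) y = 0.
    apply/rowP => i; rewrite !mxE (_ : (fun _ => _) = cst 0) ?derive_cst//.
    by apply/funext => u; rewrite X0 !fenchel0 subrr.
  have I0 g : (\int[mu]_(x in X) g x = 0)%E by rewrite X0 integral_set0.
  have S0 : sqnorm (0 : 'rV[R]_d) = 0 by rewrite /sqnorm /dot big1// => i _; rewrite mxE mul0r.
  have JJ : semidual X Y mu nu phi z = semidual X Y mu nu phi z0.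
    rewrite /semidual !I0 !add0e.
    by apply: eq_integral => y _; rewrite X0 !fenchel0.
  have fin : semidual X Y mu nu phi z0 \is a fin_num by rewrite (semidualE _ cz0).
  rewrite JJ (subee fin) I0 [X in (_ * X + _ + _)%E]integral0_eq; last first.
    by move=> y _; rewrite E1 S0 mulr0.
  rewrite [X in (_ + _ * X + _)%E]integral0_eq; last first.
    by move=> y _; rewrite X0 !fenchel0 subrr expr0n.
  by rewrite !mule0 !adde0.
pose G y : \bar R := (derive1 phis (fenchel X z0 y - q y)
         * sqnorm (grad (fun u => fenchel X z0 u - fenchel X z u) y))%:E.
have G0 y : (0 <= G y)%E.
  by rewrite lee_fin mulr_ge0 ?sqnorm_ge0//; exact: derivable_derive1_ge0.
have sq0 (r : R) : (0 <= (r ^+ 2)%:E)%E by rewrite lee_fin sqr_ge0.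
have liminfX x : (0 <= limn_einf (fun n => (defX n x)%:E))%E.
  by apply: (@le_limn_einf _ _ _ 0) => n _; exact: defX_ge0.
have liminfY y : (0 <= limn_einf (fun n => (defY n y)%:E))%E.
  by apply: (@le_limn_einf _ _ _ 0) => n _; exact: defY_ge0.
apply: le_trans (fatou_bound X0); rewrite [leRHS]addeC; apply: leeD; last first.
  apply: le_trans (lower_integralZ _ _ _ _ a20 _) _ => //.
  apply: ae_le_lower_integral => //.
  - exact: compact_measurable_rV.
  - by move=> x _; rewrite mule_ge0// lee_fin.
  - by apply: measurable_limn_einf => n; exact: measX.
  apply: (@filterS _ _ (ae_filter_ringOfSetsType mu) _ _ _ aeX) => x HK Xx; have [Kz Kz0] := HK Xx.
  rewrite -EFinM; apply: le_limn_einf_eps => e e0.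
  set w := (z0 x - z x) ^+ 2.
  have w0 : 0 <= alpha / 2 * w by rewrite mulr_ge0// sqr_ge0.
  have w1 : 0 < alpha / 2 * w + 1 by lra.
  have [N HN] := eventually_inv _ (divr_gt0 e0 w1).
  exists N => n /HN; rewrite ler_pdivlMr// => tn.
  apply: le_trans (defect_ge0 phis mono K alpha n _ _ _ sK Kz0 Kz a0 (mixX n x)).
  have -> : (z x - q x - (z0 x - q x)) ^+ 2 = w by rewrite /w; ring.
  have /andP[tn0 _] := t01 n.
  by move: tn tn0; move: (n.+1%:R^-1) => t tn tn0; lra.
apply: (@le_trans _ _ (\int[nu]_(y in Y) ((lambda / 2)%:E * G y)
  + \int[nu]_(y in Y) ((alpha / 2)%:E * ((fenchel X z0 y - fenchel X z y) ^+ 2)%:E))%E).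
  by apply: leeD; apply: lower_integralZ => // y _; exact: G0.
apply: le_trans (lower_integralD_in _ _ _ _ _ _) _.
- by move=> y _; rewrite mule_ge0// lee_fin.
- by move=> y _; rewrite mule_ge0// lee_fin.
apply: ae_le_lower_integral => //.
- exact: compact_measurable_rV.
- by move=> y _; rewrite adde_ge0// mule_ge0// lee_fin.
- by apply: measurable_limn_einf => n; exact: measY.
have [L _ HL] := compact_coord_bound X cX.
have smooth w : {within X, continuous w} -> {ae nu, forall y, smooth_point (fenchel X w) y}.
  move=> cw; apply: (@ae_smooth_point _ _ nu _ L) => //.
  - exact: fenchel_convex.
  - exact: fenchel_coord_lipschitz.
  - exact: fenchel_continuousT.
apply: (@filterS3 _ _ (ae_filter_ringOfSetsType nu) _ _ _ _ _ aeY (smooth _ cz) (smooth _ cz0)) => y HK s1 s2 Yy; have [Kz Kz0] := HK Yy.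
rewrite /G -!EFinM -EFinD; apply: le_limn_einf_eps => e e0.
exact: (conjugate_defect phis dphis mono X z z0 cX cz cz0 K alpha lambda y e X0 sz s1 s2 sK a0 Kz Kz0 e0).
Qed.

End stability.

(** * Uniqueness of the optimum and uniform constants *)

Section constants.
Context {R : realType} {d : nat} (X Y : set 'rV[R]_d).
Variables (mu nu : {finite_measure set (borelRV R d) -> \bar R}) (phi : R -> \bar R).
Hypotheses (cX : compact X) (cY : compact Y) (phiE : entropy_function phi)
  (phifin : forall s, legendre phi s \is a fin_num).
Let phis s := fine (legendre phi s).
Hypotheses (dphis : forall s, derivable phis s 1) (nuL : nu `<< @lebesgue_rV R d).
Implicit Types z : 'rV[R]_d -> R.

(** The constant is required to work for every optimal potential at once,
    since it may depend on [z] only. *)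
Definition stable_with z (c : R) : Prop := forall (lambda : R) z0, 0 < lambda ->
  Cb X z -> strongly_convex_on X lambda z -> optimal_potential X Y mu nu phi z0 ->
  ((lambda / 2)%:E *
      (\int[nu]_(y in Y) (derive1 phis (fenchel X z0 y - q y)
         * sqnorm (grad (fun u => fenchel X z0 u - fenchel X z u) y))%:E)
    + c%:E * (\int[nu]_(y in Y) ((fenchel X z0 y - fenchel X z y) ^+ 2)%:E)
    + c%:E * (\int[mu]_(x in X) ((z0 x - z x) ^+ 2)%:E)
    <= semidual X Y mu nu phi z - semidual X Y mu nu phi z0)%E.

Lemma stable_with0 z : stable_with z 0.
Proof.
move=> lambda z0 l0 Cz sz oz0.
have vz := strongly_convex_convex X lambda z (ltW l0) sz.
have ae0 (m : {finite_measure set (borelRV R d) -> \bar R}) (P : 'rV[R]_d -> Prop) :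
    (forall x, P x) -> {ae m, forall x, P x} by move=> HP; apply: aeW.
have := semidual_gap X Y mu nu phi cX cY phiE phifin dphis z z0 Cz vz oz0 setT 0 lambda
  nuL (ltW l0) sz (lexx 0) (phis_strongly0 phi phiE phifin)
  (ae0 mu _ (fun x _ => conj I I)) (ae0 nu _ (fun y _ => conj I I)).
by rewrite mul0r.
Qed.

Lemma strongly_on_compacts (A : R) : strongly_convex_on_compacts phis ->
  exists2 a : R, 0 < a & strongly_on phis `[- A, A]%classic a.
Proof.
move=> /(_ `[- A, A]%classic (@segment_compact _ _ _))[a a0 cvx]; exists a => //.
move=> s s' t Ks Ks' /andP[t0 t1].
have := cvx (Itv01 t0 t1) s s' (mem_set Ks) (mem_set Ks').
rewrite convRE /conv /= -![_ *: _]/(_ * _) /unstable.onem => h.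
lra.
Qed.

Lemma strongly_on_le (K : set R) a b : b <= a -> strongly_on phis K a -> strongly_on phis K b.
Proof.
move=> ba sK s s' t Ks Ks' t01; apply: le_trans (sK _ _ _ Ks Ks' t01) _.
have /andP[t0 t1] := t01.
have : 0 <= (a - b) * (t * (1 - t) * (s - s') ^+ 2).
  apply: mulr_ge0; first by rewrite subr_ge0.
  by apply: mulr_ge0; [apply: mulr_ge0; rewrite ?subr_ge0|exact: sqr_ge0].
lra.
Qed.

(** The gap between two optimal values is zero, so the quadratic terms of the
    estimate vanish. *)
Lemma optimal_unique z0 z1 : strongly_convex_on_compacts phis ->
  optimal_potential X Y mu nu phi z0 -> optimal_potential X Y mu nu phi z1 ->
  {ae mu, forall x, X x -> z0 x = z1 x} /\
  {ae nu, forall y, Y y -> fenchel X z0 y = fenchel X z1 y}.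
Proof.
move=> sc o0 o1; have [C0 v0 m0] := o0; have [C1 v1 m1] := o1.
have [c0 _] := C0; have [c1 _] := C1.
have [B0 HB0] := compact_bound _ _ cX (within_potential _ _ c0).
have [B1 HB1] := compact_bound _ _ cX (within_potential _ _ c1).
have [D0 HD0] := compact_bound _ _ cY (within_conjugate X Y _ cX c0).
have [D1 HD1] := compact_bound _ _ cY (within_conjugate X Y _ cX c1).
pose A := `|B0| + `|B1| + `|D0| + `|D1|.
have KA (r B : R) : `|r| <= B -> `|B| <= A -> `[- A, A]%classic r.
  move=> rB BA; rewrite /= in_itv /= -ler_norml.
  exact: le_trans (le_trans rB (ler_norm _)) BA.
have nn := (normr_ge0 B0, normr_ge0 B1, normr_ge0 D0, normr_ge0 D1).
have [leB0 leB1] : `|B0| <= A /\ `|B1| <= A by rewrite /A; split; move: nn => [[[? ?] ?] ?]; lra.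
have [leD0 leD1] : `|D0| <= A /\ `|D1| <= A by rewrite /A; split; move: nn => [[[? ?] ?] ?]; lra.
have [a a0 sK] := strongly_on_compacts A sc.
have := semidual_gap X Y mu nu phi cX cY phiE phifin dphis z1 z0 C1 v1 o0 _ a 0
  nuL (lexx 0) (convex_strongly_convex0 X z1 v1) (ltW a0) sK.
have aeX : {ae mu, forall x, X x -> `[- A, A]%classic (z1 x - q x) /\ `[- A, A]%classic (z0 x - q x)}.
  by apply: aeW => x Xx; split; [apply: KA (HB1 _ Xx) _|apply: KA (HB0 _ Xx) _].
have aeY : {ae nu, forall y, Y y -> `[- A, A]%classic (fenchel X z1 y - q y) /\ `[- A, A]%classic (fenchel X z0 y - q y)}.
  by apply: aeW => y Yy; split; [apply: KA (HD1 _ Yy) _|apply: KA (HD0 _ Yy) _].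
move=> /(_ aeX aeY).
have -> : semidual X Y mu nu phi z1 = semidual X Y mu nu phi z0.
  by apply/le_anti/andP; split; [exact: m1|exact: m0].
have fin : semidual X Y mu nu phi z0 \is a fin_num.
  by rewrite (semidualE X Y mu nu phi cX cY phifin dphis z0 c0).
rewrite (subee fin).
rewrite mul0r mul0e add0e.
have cdX := within_continuousB X _ _ c0 c1.
have cdY : {within Y, continuous (fun y => fenchel X z0 y - fenchel X z1 y)}.
  by apply: within_continuousB; apply: continuous_subspaceT; exact: fenchel_continuousT.
have null (m : {finite_measure set (borelRV R d) -> \bar R}) (D : set 'rV[R]_d)
    (u v : 'rV[R]_d -> R) : compact D -> {within D, continuous (fun x => u x - v x)} ->
    (\int[m]_(x in D) ((u x - v x) ^+ 2)%:E <= 0)%E ->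
    {ae m, forall x, D x -> u x = v x}.
  move=> cD cw le0.
  have mf : measurable_fun (D : set (borelRV R d)) (fun x => ((u x - v x) ^+ 2)%:E).
    apply/measurable_EFinP; apply: within_continuous_measurable => //.
    exact: (within_continuous_comp D (fun r => r ^+ 2) _ (@exprn_continuous R 2) cw).
  have /(ae_eq_integral_abs m (compact_measurable_rV _ cD) mf) :
      (\int[m]_(x in D) `|((u x - v x) ^+ 2)%:E| = 0)%E.
    apply/eqP; rewrite eq_le; apply/andP; split; last by apply: integral_ge0 => x _; exact: abse_ge0.
    apply: le_trans le0; apply: le_lower_integral => x _; first exact: abse_ge0.
    by rewrite gee0_abs// lee_fin sqr_ge0.
  apply: (@filterS _ _ (ae_filter_ringOfSetsType m)) => x /= H Dx.
  by have /eqP := H Dx; rewrite eqe sqrf_eq0 subr_eq0 => /eqP.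
have a20 : 0 < a / 2 by rewrite divr_gt0.
have pos (m : {finite_measure set (borelRV R d) -> \bar R}) (D : set 'rV[R]_d) (u v : 'rV[R]_d -> R) :
  (0 <= \int[m]_(x in D) ((u x - v x) ^+ 2)%:E)%E.
  by apply: integral_ge0 => x _; rewrite lee_fin sqr_ge0.
have a2e : (0 <= (a / 2)%:E)%E by rewrite lee_fin ltW.
move=> H; split; apply: null => //.
  rewrite -(@pmule_rle0 _ (a / 2)%:E) ?lte_fin//; apply: le_trans H.
  by rewrite leeDr// mule_ge0.
rewrite -(@pmule_rle0 _ (a / 2)%:E) ?lte_fin//; apply: le_trans H.
by rewrite leeDl// mule_ge0.
Qed.

(** One optimal potential fixes an interval for [z0 - q] and its conjugate; by
    uniqueness this interval serves, up to null sets, for every other one. *)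
Lemma stable_with_uniform (lambda M : R) : strongly_convex_on_compacts phis -> exists n : nat,
  forall z, Cb X z -> strongly_convex_on X lambda z ->
    (forall x, supp mu x -> `|z x| <= M) ->
    (forall y, supp nu y -> `|fenchel X z y| <= M) -> stable_with z n.+1%:R^-1.
Proof.
move=> sc.
have [[z1 o1]|no] := pselect (exists z1, optimal_potential X Y mu nu phi z1); last first.
  (* without an optimal potential every constant is admissible *)
  by exists 0 => z _ _ _ _ lam z0 _ _ _ o0; case: no; exists z0.
have [[c1 _] v1 _] := o1.
have [B1 HB1] := compact_bound _ _ cX (within_potential _ _ c1).
have [D1 HD1] := compact_bound _ _ cY (within_conjugate X Y _ cX c1).
have [QX HQX] := compact_bound _ _ cX (continuous_subspaceT (@continuous_q R d)).
have [QY HQY] := compact_bound _ _ cY (continuous_subspaceT (@continuous_q R d)).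
pose A := `|B1| + `|D1| + `|QX| + `|QY| + `|M|.
have nn : [/\ 0 <= `|B1|, 0 <= `|D1|, 0 <= `|QX|, 0 <= `|QY| & 0 <= `|M|] by split; exact: normr_ge0.
have KA (r : R) : `|r| <= A -> `[- A, A]%classic r by rewrite /= in_itv /= -ler_norml.
have [a a0 sK] := strongly_on_compacts A sc.
have [n Hn] := eventually_inv _ (divr_gt0 a0 (ltr0n _ 2)).
exists n => z Cz sz zM zcM lam z0 lam0 _ szl oz0.
have [cz _] := Cz.
have vz := strongly_convex_convex X lam z (ltW lam0) szl.
have [uX uY] := optimal_unique _ _ sc oz0 o1.
have bX := ae_bound_supp mu X z M cX cz zM.
have bY := ae_bound_supp nu Y (fenchel X z) M cY
  (continuous_subspaceT (fenchel_continuousT X z cX cz)) zcM.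
have sub (u r Q : R) : `|u| <= M -> `|r| <= Q -> `|Q| + `|M| <= A -> `|u - r| <= A.
  move=> uM rQ QM; apply: le_trans (ler_normB _ _) _; apply: le_trans QM.
  by rewrite addrC; apply: lerD; [exact: le_trans rQ (ler_norm _)|exact: le_trans uM (ler_norm _)].
have big (u B : R) : `|u| <= B -> `|B| <= A -> `|u| <= A.
  by move=> uB; apply: le_trans; exact: le_trans uB (ler_norm _).
have aeX : {ae mu, forall x, X x -> `[- A, A]%classic (z x - q x) /\ `[- A, A]%classic (z0 x - q x)}.
  apply: (@filterS2 _ _ (ae_filter_ringOfSetsType mu) _ _ _ _ bX uX) => x hb hu Xx.
  split; apply: KA; first by apply: sub (hb Xx) (HQX _ Xx) _; rewrite /A; case: nn; lra.
  by rewrite (hu Xx); apply: big (HB1 _ Xx) _; rewrite /A; case: nn; lra.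
have aeY : {ae nu, forall y, Y y -> `[- A, A]%classic (fenchel X z y - q y) /\ `[- A, A]%classic (fenchel X z0 y - q y)}.
  apply: (@filterS2 _ _ (ae_filter_ringOfSetsType nu) _ _ _ _ bY uY) => y hb hu Yy.
  split; apply: KA; first by apply: sub (hb Yy) (HQY _ Yy) _; rewrite /A; case: nn; lra.
  by rewrite (hu Yy); apply: big (HD1 _ Yy) _; rewrite /A; case: nn; lra.
have n0 : 0 <= n.+1%:R^-1 :> R by rewrite invr_ge0.
have alpha0 : 0 <= 2 * n.+1%:R^-1 :> R by rewrite mulr_ge0.
have sK' : strongly_on phis `[- A, A]%classic (2 * n.+1%:R^-1).
  apply: strongly_on_le sK; rewrite mulrC -ler_pdivlMr//; exact: Hn.
have := semidual_gap X Y mu nu phi cX cY phiE phifin dphis z z0 Cz vz oz0 _ _ lam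
  nuL (ltW lam0) szl alpha0 sK' aeX aeY.
by rewrite [2 * _]mulrC mulfK// pnatr_eq0.
Qed.

(** The candidates are the numbers [1 / (n + 1)], of which there is a largest
    admissible one if any; this avoids passing to a supremum. *)
Lemma stability_constant z : exists c : R, [/\ 0 <= c, stable_with z c &
  forall n, stable_with z n.+1%:R^-1 -> n.+1%:R^-1 <= c].
Proof.
have [ex|no] := pselect (exists n, `[< stable_with z n.+1%:R^-1 >]); last first.
  exists 0; split => //; first exact: stable_with0.
  by move=> n sn; case: no; exists n; apply/asboolP.
have [n /asboolP sn nmin] := ex_minnP ex.
exists n.+1%:R^-1; split => // m sm.
rewrite ler_pV2 ?inE ?unitfE ?pnatr_eq0 ?ltr0n//= ler_nat ltnS.
by apply: nmin; apply/asboolP.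
Qed.

End constants.

Theorem proposition2 (R : realType) (d : nat) (X Y : set 'rV[R]_d)
    (mu nu : {finite_measure set (borelRV R d) -> \bar R})
    (phi : R -> \bar R) :
  let J := semidual X Y mu nu phi in
  let phis := fun s : R => fine (legendre phi s) in
  let conj := fenchel X in
  compact X -> compact Y ->
  mu (~` X) = 0%E -> nu (~` Y) = 0%E ->
  entropy_function phi ->
  (forall (z1 z2 : 'rV[R]_d -> R) (t : R), Cb X z1 -> Cb X z2 -> 0 <= t <= 1 ->
     (J (fun x => (t * z1 x + (1 - t) * z2 x)%R)
        <= t%:E * J z1 + (1 - t)%R%:E * J z2)%E)
  /\
  ((forall s, legendre phi s \is a fin_num) ->
   (forall s, derivable phis s 1) ->
   nu `<< @lebesgue_rV R d ->
   exists Cz Czs : ('rV[R]_d -> R) -> R,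
   [/\ forall z, 0 <= Cz z /\ 0 <= Czs z,
       forall (lambda : R) (z z0 : 'rV[R]_d -> R), 0 < lambda ->
         Cb X z -> strongly_convex_on X lambda z ->
         optimal_potential X Y mu nu phi z0 ->
         ((lambda / 2)%:E *
            (\int[nu]_(y in Y) (derive1 phis (conj z0 y - q y)
               * sqnorm (grad (fun u => conj z0 u - conj z u) y))%:E)
          + (Czs z)%:E * (\int[nu]_(y in Y) ((conj z0 y - conj z y) ^+ 2)%:E)
          + (Cz z)%:E * (\int[mu]_(x in X) ((z0 x - z x) ^+ 2)%:E)
          <= J z - J z0)%E &
       strongly_convex_on_compacts phis ->
       forall (lambda M : R), 0 < lambda ->
         exists2 C' : R, 0 < C' &
           forall z : 'rV[R]_d -> R,
             Cb X z -> strongly_convex_on X lambda z ->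
             (forall x, supp mu x -> `|z x| <= M) ->
             (forall y, supp nu y -> `|conj z y| <= M) ->
             C' <= Cz z /\ C' <= Czs z]).
Proof.
move=> J phis conj cX cY _ _ phiE; split.
  move=> z1 z2 t [c1 _] [c2 _] t01; exact: semidual_convex.
move=> phifin dphis nuL.
have /choice[C HC] := stability_constant X Y mu nu phi cX cY phiE phifin dphis nuL.
exists C, C; split.
- by move=> z; have [] := HC z.
- by move=> lambda z z0 l0 Cz sz oz0; have [_ sC _] := HC z; exact: sC.
move=> sc lambda M l0.
have [n Hn] := stable_with_uniform X Y mu nu phi cX cY phiE phifin dphis nuL lambda M sc.
exists n.+1%:R^-1; first by rewrite invr_gt0 ltr0n.
move=> z Cz sz zM zcM; have [_ _ max] := HC z.
by have := max _ (Hn z Cz sz zM zcM).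
Qed.
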